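(* Let $G$ be an even-hole-free graph, and let $a\in V(G)$ be splendid. Suppose there is no extended near-prism contained in $G$ (as an induced subgraph) such that $a$ is an end of its cross-edge. Let $\mathcal{S}=(a,S_1,\dots,S_k)$ be an indecomposable pyramid strip system in $G$ with apex $a$, with strips $S_i=(A_i,B_i,C_i)$ for $1\le i\le k$, chosen with $V(\mathcal{S})$ maximal (under inclusion, among all indecomposable pyramid strip systems in $G$ with apex $a$). Then for each component $F$ of $G\setminus (V(\mathcal{S})\cup N[a])$, either $\mathcal{S}(F)$ is a nonempty subset of $B_1\cup\cdots\cup B_k$, or for some $i\in\{1,\dots,k\}$, $\mathcal{S}(F)$ is a subset of $V(S_i)$ and has nonempty intersection with $B_i\cup C_i$.
   Context: All graphs are finite and simple. A hole is an induced cycle of length at least four; a graph is even-hole-free if it has no hole of even length. $N(a)$ is the set of neighbours of $a$, $N[a]=N(a)\cup\{a\}$. $G\setminus X$ is the subgraph induced on $V(G)\setminus X$. A set of vertices is connected if it induces a connected subgraph. Disjoint vertex sets are complete (anticomplete) to each other if all (no) edges between them are present. For a path $R$, $R^*$ is its set of internal vertices; the length of a path is its number of edges. A pyramid with apex $a$ and base $\{b_1,b_2,b_3\}$ is a graph in which $a,b_1,b_2,b_3$ are distinct, $\{b_1,b_2,b_3\}$ is a triangle, and which is the union of this triangle and three paths $R_1,R_2,R_3$, where $R_i$ has ends $a,b_i$, pairwise vertex-disjoint except for the common end $a$, at least two of them having length at least two. It is short if one of $R_1,R_2,R_3$ has length one. A near-prism is a graph that is the union of two triangles $\{a_1,a_2,a_3\},\{b_1,b_2,b_3\}$,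 which are disjoint except that possibly $a_3=b_3$, and three pairwise vertex-disjoint paths $R_1,R_2,R_3$, where $R_i$ has ends $a_i,b_i$ (so $R_3$ has length zero if $a_3=b_3$). An extended near-prism is obtained from such a near-prism by adding one extra edge $xy$ with $x\in R_1^*$ and $y\in R_2^*$; $xy$ is its cross-edge. A vertex $a\in V(G)$ is splendid if: $V(G)\setminus N[a]$ is connected; every vertex in $N(a)$ has a neighbour in $V(G)\setminus N[a]$; and $G$ contains no short pyramid with apex $a$ as an induced subgraph. A proper strip is a triple $S=(A,B,C)$ of pairwise disjoint subsets of $V(G)$ with $A,B\ne\emptyset$ such that every vertex of $V(S):=A\cup B\cup C$ lies in an $S$-rung, where an $S$-rung is an induced path $p_1,\dots,p_k$ of $G[A\cup B\cup C]$ with $p_1\in A$, $p_k\in B$, $p_2,\dots,p_{k-1}\in C$. It is indecomposable if $A\cup C$ is connected. A pyramid strip system $\mathcal{S}=(a,S_1,\dots,S_k)$ in $G$ consists of proper strips $S_i=(A_i,B_i,C_i)$, $1\le i\le k$, with $k\ge3$, with $V(S_1),\dots,V(S_k)$ pairwise disjoint, and a vertex $a$ (the apex), such that: for $i<j$, $B_i$ is complete to $B_j$ and there are no other edges between $V(S_i)$ and $V(S_j)$; $a\notin V(S_i)$ for all $i$; and for all $i$, $a$ is complete to $A_i$ and anticomplete to $B_i\cup C_i$. It is indecomposable if all its strips are. $V(\mathcal{S})=V(S_1)\cup\cdots\cup V(S_k)\cup\{a\}$. For an induced subgraph $F$ of $G$ with $V(F)\subseteq V(G)\setminus V(\mathcal{S})$,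 $\mathcal{S}(F)$ is the set of vertices of $V(\mathcal{S})$ with a neighbour in $V(F)$. *)

(* Defs.v *)
From mathcomp Require Import all_boot.

Set Implicit Arguments.
Unset Strict Implicit.
Unset Printing Implicit Defensive.

(* A graph is a symmetric irreflexive relation [e] on a finite type [T]; its
   induced subgraphs are identified with their vertex sets.  Paths and cycles
   are duplicate-free sequences of vertices. *)

Section Graphs.
Variables (T : finType) (e : rel T).

Definition nbh (a : T) : {set T} := [set v | e a v].
Definition cnbh (a : T) : {set T} := a |: nbh a.

(* The empty set counts as connected, but not as a component. *)
Definition connected_set (X : {set T}) : bool :=
  [forall x in X, forall y in X,
     connect [rel u v | [&& u \in X, v \in X & e u v]] x y].

Definition component (X F : {set T}) : bool :=
  (F != set0) && maxset [pred Y : {set T} | (Y \subset X) && connected_set Y] F.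

Definition hole (c : seq T) : Prop :=
  [/\ 4 <= size c, uniq c &
      {in c &, forall x y, e x y = (y == next c x) || (x == next c y)}].

Definition even_hole_free : Prop := forall c, hole c -> odd (size c).

(* Adjacency in the path whose successive vertices are listed by [p]. *)
Definition path_adj (p : seq T) : rel T :=
  [rel x y | ((x, y) \in zip p (behead p)) || ((y, x) \in zip p (behead p))].

Definition path_ends (u v : T) (p : seq T) : Prop :=
  [/\ uniq p, ohead p = Some u & last u p = v].

Definition interior (p : seq T) : seq T :=
  if p is x :: q then behead (belast x q) else [::].

Definition induced_path (p : seq T) : Prop :=
  uniq p /\ {in p &, forall x y, e x y = path_adj p x y}.

Definition triangle_adj (b : 'I_3 -> T) : rel T :=
  [rel x y | [&& x != y, x \in codom b & y \in codom b]].

Definition paths_adj (R : 'I_3 -> seq T) : rel T :=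
  [rel x y | [exists i, path_adj (R i) x y]].

Definition paths_vertices (R : 'I_3 -> seq T) : {set T} :=
  [set x | [exists i, x \in R i]].

(* [e] restricted to [X] is exactly [r]: the graph with vertex set [X] and
   adjacency [r] is an induced subgraph. *)
Definition induces (X : {set T}) (r : rel T) : Prop :=
  {in X &, forall x y, e x y = r x y}.

(* A path of length l is a sequence of size l + 1. *)
Definition induced_pyramid (a : T) (b : 'I_3 -> T) (R : 'I_3 -> seq T) : Prop :=
  [/\ injective b /\ (forall i, b i != a),
      forall i, path_ends a (b i) (R i),
      forall i j, i != j -> forall x, x \in R i -> x \in R j -> x = a,
      2 <= #|[set i | 3 <= size (R i)]|
    & induces (paths_vertices R)
        [rel x y | triangle_adj b x y || paths_adj R x y]].

Definition induced_short_pyramid (a : T) (b : 'I_3 -> T) (R : 'I_3 -> seq T) :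
    Prop :=
  induced_pyramid a b R /\ exists i, size (R i) = 2.

(* Indices 1, 2, 3 are [ord0], [ord1_3] and [ord_max]. *)
Definition ord1_3 : 'I_3 := Ordinal (isT : 1 < 3).

Definition near_prism_data (a b : 'I_3 -> T) (R : 'I_3 -> seq T) : Prop :=
  [/\ injective a, injective b,
      forall i j, a i = b j -> i = ord_max /\ j = ord_max,
      forall i, path_ends (a i) (b i) (R i)
    & forall i j, i != j -> forall x, x \in R i -> x \notin R j].

Definition near_prism_adj (a b : 'I_3 -> T) (R : 'I_3 -> seq T) : rel T :=
  [rel u v | [|| triangle_adj a u v, triangle_adj b u v | paths_adj R u v]].

(* [x y] is the cross-edge. *)
Definition induced_extended_near_prism (a b : 'I_3 -> T) (R : 'I_3 -> seq T)
    (x y : T) : Prop :=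
  [/\ near_prism_data a b R,
      x \in interior (R ord0), y \in interior (R ord1_3)
    & induces (paths_vertices R)
        [rel u v | [|| near_prism_adj a b R u v,
                       (u == x) && (v == y) | (u == y) && (v == x)]]].

Definition splendid (a : T) : Prop :=
  [/\ connected_set (~: cnbh a),
      forall v, v \in nbh a -> exists2 w, w \in ~: cnbh a & e v w
    & forall b R, ~ induced_short_pyramid a b R].

Record strip := Strip { sA : {set T}; sB : {set T}; sC : {set T} }.

Definition strip_vertices (S : strip) : {set T} := sA S :|: sB S :|: sC S.

Definition rung (S : strip) (p : seq T) : Prop :=
  induced_path p /\
  exists u v, [/\ path_ends u v p, u \in sA S, v \in sB S
                & {subset interior p <= sC S}].

Definition proper_strip (S : strip) : Prop :=
  [/\ [/\ [disjoint sA S & sB S], [disjoint sA S & sC S]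
        & [disjoint sB S & sC S]],
      sA S != set0, sB S != set0
    & forall v, v \in strip_vertices S -> exists2 p, rung S p & v \in p].

Definition indecomposable_strip (S : strip) : bool :=
  connected_set (sA S :|: sC S).

Definition pyramid_strip_system (a : T) (k : nat) (S : 'I_k -> strip) : Prop :=
  [/\ 3 <= k,
      forall i, proper_strip (S i),
      forall i j, i != j ->
        [disjoint strip_vertices (S i) & strip_vertices (S j)],
      forall i j : 'I_k, i < j ->
        {in strip_vertices (S i) & strip_vertices (S j),
          forall x y, e x y = (x \in sB (S i)) && (y \in sB (S j))}
    & forall i, a \notin strip_vertices (S i) /\
        {in strip_vertices (S i), forall x, e a x = (x \in sA (S i))}].

Definition indecomposable_system (a : T) (k : nat) (S : 'I_k -> strip) : Prop :=
  pyramid_strip_system a S /\ forall i, indecomposable_strip (S i).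

Definition system_vertices (a : T) (k : nat) (S : 'I_k -> strip) : {set T} :=
  a |: \bigcup_i strip_vertices (S i).

Definition maximal_indecomposable_system (a : T) (k : nat)
    (S : 'I_k -> strip) : Prop :=
  indecomposable_system a S /\
  forall (k' : nat) (S' : 'I_k' -> strip),
    indecomposable_system a S' ->
    system_vertices a S \subset system_vertices a S' ->
    system_vertices a S' = system_vertices a S.

Definition attachments (a : T) (k : nat) (S : 'I_k -> strip) (F : {set T}) :
    {set T} :=
  [set v in system_vertices a S | [exists u in F, e v u]].

End Graphs.

(* Main.v *)
Require Import Defs.
From mathcomp Require Import all_boot.
From mathcomp Require Import zify.

Set Implicit Arguments.
Unset Strict Implicit.
Unset Printing Implicit Defensive.

(** Two rungs in different strips close, through the apex [a] and their ends in
    the sets [B], to an odd hole; as there are three strips, all rungs have the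
    same parity.  If the theorem fails, take a shortest induced path [F] in the
    component whose ends [f], [g] have neighbours in [A_i :|: C_i] and in
    [V(S_j)], for some [i != j].

    Suppose that [g] has neighbours in [A_j :|: C_j], and take rungs [p], [q]
    through neighbours of [f], [g], and a rung [r] of a third strip.  If [F] is a
    single vertex with a neighbour in [r], then the first neighbours of this
    vertex on [p], [q], [r] have pairwise different parities of distance to [a],
    which is absurd.  Otherwise [F] is anticomplete to [r], and parity of holes
    forces [f] to have on [p] either one neighbour, which is in [A_i], or exactly
    two, which are adjacent; likewise for [g] on [q].  If [p] and [q] are of the
    same kind there is an even hole; if not, there is an extended near-prism
    whose cross-edge joins [a] to the single neighbour.

    Suppose that [g] has neighbours only in the sets [B_l] with [l != i].  If it
    misses a vertex of one of them while seeing one of another, two holes of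
    different parities arise.  So [g] is complete to all of them, and [F] can be
    added to the strip [S_i], contrary to maximality. *)

(** * Induced paths and holes *)

Section InducedPaths.
Variables (T : finType) (e : rel T).
Hypotheses (e_sym : symmetric e) (e_irr : irreflexive e).
Implicit Types (a u v w x y z f g : T) (p q r s : seq T).

Definition ipath u p v := induced_path e p /\ path_ends u v p.

(** Disjointness is built in and the edge itself is not asserted, so the notion passes to sublists
    and [anti] is a special case of it. *)
Definition only_edge p q x y :=
  {in p & q, forall z w, z != w /\ (e z w -> z = x /\ w = y)}.

Definition anti p q := {in p & q, forall z w, z != w /\ ~~ e z w}.

Lemma only_edge_sym p q x y : only_edge p q x y -> only_edge q p y x.
Proof.
by move=> H z w zq wp; have [n h] := H _ _ wp zq; rewrite eq_sym e_sym; split=> // /h[].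
Qed.

Lemma anti_sym p q : anti p q -> anti q p.
Proof. by move=> H z w zq wp; rewrite eq_sym e_sym; apply: H. Qed.

Lemma only_edge_sub p q p' q' x y : {subset p' <= p} -> {subset q' <= q} ->
  only_edge p q x y -> only_edge p' q' x y.
Proof. by move=> sp sq H z w zp wq; apply: H; [apply: sp | apply: sq]. Qed.

Lemma anti_sub p q p' q' : {subset p' <= p} -> {subset q' <= q} ->
  anti p q -> anti p' q'.
Proof. by move=> sp sq H z w zp wq; apply: H; [apply: sp | apply: sq]. Qed.

Lemma only_edge_anti p q x y : anti p q -> only_edge p q x y.
Proof. by move=> H z w zp wq; have [? /negbTE->] := H _ _ zp wq. Qed.

Lemma anti_only_edge p q x y : only_edge p q x y -> x \notin p -> anti p q.
Proof.
move=> H xp z w zp wq; have [n h] := H _ _ zp wq; split=> //.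
by apply/negP=> /h[zx _]; rewrite -zx zp in xp.
Qed.

Lemma only_edge_catl p1 p2 q x y :
  only_edge p1 q x y -> only_edge p2 q x y -> only_edge (p1 ++ p2) q x y.
Proof.
by move=> H1 H2 z w; rewrite mem_cat => /orP[h|h] wq; [apply: H1 | apply: H2].
Qed.

Lemma only_edge_catr p q1 q2 x y :
  only_edge p q1 x y -> only_edge p q2 x y -> only_edge p (q1 ++ q2) x y.
Proof.
by move=> H1 H2 z w zp; rewrite mem_cat => /orP[h|h]; [apply: H1 | apply: H2].
Qed.

Lemma only_edge_revr p q x y : only_edge p q x y -> only_edge p (rev q) x y.
Proof. by apply: only_edge_sub => // z; rewrite mem_rev. Qed.

Lemma anti_catr p q1 q2 : anti p q1 -> anti p q2 -> anti p (q1 ++ q2).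
Proof.
by move=> H1 H2 z w zp; rewrite mem_cat => /orP[h|h]; [apply: H1 | apply: H2].
Qed.

Lemma anti_revr p q : anti p q -> anti p (rev q).
Proof. by apply: anti_sub => // z; rewrite mem_rev. Qed.

Lemma mem_zip2 (s t : seq T) x y : (x, y) \in zip s t -> x \in s /\ y \in t.
Proof.
elim: s t => [|z s IH] [|w t] //=; rewrite !inE xpair_eqE.
by case/orP=> [/andP[-> ->]|/IH[-> ->]] //; rewrite !orbT.
Qed.

Lemma path_adj_mem p x y : path_adj p x y -> x \in p /\ y \in p.
Proof. by case/orP=> /mem_zip2[h1 /mem_behead h2]. Qed.

Lemma path_adj_sym p x y : path_adj p x y = path_adj p y x.
Proof. by rewrite /path_adj /= orbC. Qed.

(** The consecutive pairs of a concatenation are those of the two pieces and the single junction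
    pair [(v, w)]. *)
Lemma path_adj_cat u p v w q x y : ohead p = Some u -> last u p = v ->
    ohead q = Some w ->
  path_adj (p ++ q) x y = [|| path_adj p x y, path_adj q x y,
    (x == v) && (y == w) | (x == w) && (y == v)].
Proof.
case: p => [|u0 p] //= [->] {u0} lv; case: q => [|w0 q] //= [->] {w0}.
have E : zip (u :: p ++ w :: q) (p ++ w :: q) =
          zip (u :: p) p ++ (v, w) :: zip (w :: q) q.
  by elim: p u lv => [|z p IH] u /=; [move-> | move=> lv; congr cons; apply: IH].
rewrite /path_adj /= E !mem_cat !inE !xpair_eqE ![(y == _) && _]andbC.
by do 4!case: (_ \in zip _ _); do 2!case: (_ && _).
Qed.

Lemma path_ends_cons u v p : path_ends u v p -> exists p', p = u :: p'.
Proof. by case: p => [|u0 p] [] //= _ [->] _; exists p. Qed.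

Lemma path_ends_rcons u v p : path_ends u v p -> exists p', p = rcons p' v.
Proof.
by case/lastP: p => [|p w] [] // _ _; rewrite last_rcons => ->; exists p.
Qed.

Lemma path_ends_mem u v p : path_ends u v p -> u \in p /\ v \in p.
Proof.
move=> h; split; first by have [p' ->] := path_ends_cons h; rewrite mem_head.
by have [p' ->] := path_ends_rcons h; rewrite mem_rcons mem_head.
Qed.

Lemma path_ends_rev u v p : path_ends u v p -> path_ends v u (rev p).
Proof.
move=> h; have [U _ _] := h; split; first by rewrite rev_uniq.
  by have [p' ->] := path_ends_rcons h; rewrite rev_rcons.
by have [p' ->] := path_ends_cons h; rewrite rev_cons last_rcons.
Qed.

Lemma path_ends_size u v p : path_ends u v p -> 0 < size p.
Proof. by move=> h; have [p' ->] := path_ends_cons h. Qed.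

Lemma path_adj_rev p x y : path_adj (rev p) x y = path_adj p x y.
Proof.
elim: p => [|u p IH] //; rewrite rev_cons -cats1.
case: p IH => [|w p] IH //.
have ->: path_adj (rev (w :: p) ++ [:: u]) x y =
  [|| path_adj (rev (w :: p)) x y, path_adj [:: u] x y,
    (x == w) && (y == u) | (x == u) && (y == w)].
  apply: (@path_adj_cat (last w p)) => //.
    by case/lastP: p {IH} => // p z; rewrite last_rcons -rcons_cons rev_rcons.
  by rewrite rev_cons last_rcons.
rewrite IH -cat1s (@path_adj_cat u [:: u] u w (w :: p)) //.
by case: (path_adj (w :: p) x y); case: (path_adj [:: u] x y) => //=; rewrite orbC.
Qed.

Lemma induced_path_catl p q : induced_path e (p ++ q) -> induced_path e p.
Proof.
case: p => [|u p] //; case: q => [|w q]; rewrite ?cats0 // => -[U I].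
move: (U); rewrite cat_uniq => /and3P[U1 D U2]; split=> // x y xp yp.
have nq z : z \in u :: p -> z \notin w :: q by move=> zp; apply: contraNN D => ?; apply/hasP; exists z.
rewrite I ?mem_cat ?xp ?yp // (@path_adj_cat u _ (last u p) w) //.
have ->: path_adj (w :: q) x y = false.
  by apply/negP=> /path_adj_mem[xq _]; move: (nq _ xp); rewrite xq.
have ->: x == w = false by apply: contraNF (nq _ xp) => /eqP->; rewrite mem_head.
have ->: y == w = false by apply: contraNF (nq _ yp) => /eqP->; rewrite mem_head.
by rewrite andbF !orbF.
Qed.

Lemma induced_path_rev p : induced_path e p -> induced_path e (rev p).
Proof.
case=> U I; split=> [|x y]; rewrite ?rev_uniq // !mem_rev => xp yp.
by rewrite path_adj_rev I.
Qed.

Lemma induced_path_catr p q : induced_path e (p ++ q) -> induced_path e q.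
Proof.
move=> /induced_path_rev; rewrite rev_cat => /induced_path_catl.
by move/induced_path_rev; rewrite revK.
Qed.

Lemma ipath1 x : ipath x [:: x] x.
Proof.
split; last by [].
split=> // y z; rewrite !inE => /eqP-> /eqP->; by rewrite e_irr.
Qed.

Lemma ipath_rev u p v : ipath u p v -> ipath v (rev p) u.
Proof. by case=> /induced_path_rev ? /path_ends_rev. Qed.

Lemma ipath_mem u p v : ipath u p v -> u \in p /\ v \in p.
Proof. by case=> _ /path_ends_mem. Qed.

Lemma ipath_size u p v : ipath u p v -> 0 < size p.
Proof. by case=> _ /path_ends_size. Qed.

Lemma ipath_cat u p v w q t : ipath u p v -> ipath w q t -> e v w ->
  only_edge p q v w -> ipath u (p ++ q) t.
Proof.
move=> [[U1 I1] E1] [[U2 I2] E2] evw O.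
have [_ h1 l1] := E1; have [_ h2 l2] := E2.
have [up vp] := path_ends_mem E1; have [wq tq] := path_ends_mem E2.
have U : uniq (p ++ q).
  rewrite cat_uniq U1 U2 andbT; apply/hasPn=> z zq; apply/negP=> zp.
  by have [/eqP] := O _ _ zp zq.
split; last first.
  split=> //; first by have [p' ->] := path_ends_cons E1.
  by rewrite last_cat l1; have [q' qE] := path_ends_cons E2; rewrite qE /= -l2 qE.
split=> // x y xpq ypq.
rewrite (path_adj_cat _ _ h1 l1 h2).
apply/idP/idP; last first.
  case/or4P=> [h|h|/andP[/eqP-> /eqP->]|/andP[/eqP-> /eqP->]] //.
  - by have [? ?] := path_adj_mem h; rewrite I1.
  - by have [? ?] := path_adj_mem h; rewrite I2.
  - by rewrite e_sym.
move: xpq ypq; rewrite !mem_cat => /orP[xp|xq] /orP[yp|yq] exy.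
- by rewrite -I1 // exy.
- by have [_ /(_ exy)[-> ->]] := O _ _ xp yq; rewrite !eqxx ?orbT.
- by rewrite e_sym in exy; have [_ /(_ exy)[-> ->]] := O _ _ yp xq; rewrite !eqxx ?orbT.
- by rewrite -I2 // exy ?orbT.
Qed.

Lemma ipath_prefix u p x q v : ipath u (rcons p x ++ q) v -> ipath u (rcons p x) x.
Proof.
case=> /induced_path_catl I [_ h _]; split=> //; split; first by case: I.
  by case: p h {I}.
by rewrite last_rcons.
Qed.

Lemma ipath_suffix u p y q v : ipath u (p ++ y :: q) v -> ipath y (y :: q) v.
Proof.
case=> /induced_path_catr I [_ _ h]; split=> //; split=> //; first by case: I.
by rewrite -h last_cat.
Qed.

(** Converse of [ipath_cat]: cutting an induced path leaves one edge between the two pieces, the one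
    that was cut. *)
Lemma ipath_split u p x y q v : ipath u (rcons p x ++ y :: q) v ->
  e x y /\ only_edge (rcons p x) (y :: q) x y.
Proof.
move=> P; have [_ [_ h1 l1]] := ipath_prefix P.
case: P => -[U I] _.
have A := path_adj_cat _ _ h1 l1 (erefl (ohead (y :: q))).
split.
  by rewrite I ?A ?mem_cat ?mem_rcons ?mem_head ?orbT // !eqxx !orbT.
move: (U); rewrite cat_uniq => /and3P[_ /hasPn D _] z w zp wq.
have zq : z \notin y :: q by apply/negP=> zq; case/negP: (D _ zq).
split; first by apply: contraNneq zq => ->.
rewrite I ?mem_cat ?zp ?wq ?orbT // A => /or4P[/path_adj_mem[_ h]|/path_adj_mem[h _]||].
- by case/negP: (D _ wq).
- by rewrite h in zq.
- by case/andP=> /eqP-> /eqP->.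
- by case/andP=> /eqP zy; rewrite zy mem_head in zq.
Qed.

Lemma ipath_cons a x p b : ipath x p b -> e a x ->
  only_edge [:: a] p a x -> ipath a (a :: p) b.
Proof. by move=> P ax O; apply: (ipath_cat (ipath1 a) P). Qed.

(** Reduces the cyclic successor to consecutive pairs plus the wrap-around pair; [y0] is the value
    returned at the last entry, which is the head of the list when [next] unfolds. *)
Lemma next_atE y0 y p x t : uniq (y :: p) -> x \in y :: p ->
  (t == next_at x y0 y p) =
  ((x, t) \in zip (y :: p) p) || ((x == last y p) && (t == y0)).
Proof.
elim: p y => [|z p IH] y; first by rewrite /= inE => _ ->.
rewrite cons_uniq => /andP[yzp U]; 
have -> : ((x, t) \in zip (y :: z :: p) (z :: p)) =
    (x == y) && (t == z) || ((x, t) \in zip (z :: p) p).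
  by rewrite /= inE xpair_eqE.
rewrite inE [next_at _ _ _ _]/=.
case: (eqVneq x y) => [-> _|xy /= xzp]; last by rewrite IH.
have -> : ((y, t) \in zip (z :: p) p) = false.
  by apply/negP=> /mem_zip2[h _]; rewrite h in yzp.
have -> : (y == last y (z :: p)) = false.
  by apply: contraNF yzp => /eqP->; rewrite /= mem_last.
by rewrite !orbF.
Qed.

(** Cyclic adjacency in [p ++ q] is path adjacency together with the closing pair of [t] and [u].
    All holes below are built from this lemma. *)
Lemma ipath_hole u p v w q t : ipath u p v -> ipath w q t ->
    e v w -> e t u ->
    {in p & q, forall x y, x != y /\
      (e x y -> x = v /\ y = w \/ x = u /\ y = t)} ->
  4 <= size p + size q -> hole e (p ++ q).
Proof.
move=> [[U1 I1] E1] [[U2 I2] E2] evw etu O sz.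
have [_ h1 l1] := E1; have [_ h2 l2] := E2.
have [up vp] := path_ends_mem E1; have [wq tq] := path_ends_mem E2.
have U : uniq (p ++ q).
  rewrite cat_uniq U1 U2 andbT; apply/hasPn=> z zq; apply/negP=> zp.
  by have [/eqP] := O _ _ zp zq.
split; rewrite ?size_cat // => x y xpq ypq.
have nextE x0 y0 : x0 \in p ++ q -> (y0 == next (p ++ q) x0) =
    ((x0, y0) \in zip (p ++ q) (behead (p ++ q))) || ((x0 == t) && (y0 == u)).
  have [p' pE] := path_ends_cons E1; have [q' qE] := path_ends_cons E2.
  have lpq: last u (p' ++ q) = t by rewrite last_cat qE /= -l2 qE.
  by move: U; rewrite pE /= => U xin; rewrite next_atE // lpq.
have -> : (y == next (p ++ q) x) || (x == next (p ++ q) y) =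
    path_adj (p ++ q) x y || ((x == t) && (y == u) || (y == t) && (x == u)).
  rewrite !nextE // /path_adj /=.
  by do 2!case: (_ \in zip _ _) => //=; rewrite ?orbT.
rewrite (path_adj_cat _ _ h1 l1 h2).
apply/idP/idP; last first.
  case/orP=> [/or4P[h|h|/andP[/eqP-> /eqP->]|/andP[/eqP-> /eqP->]]|/orP[]/andP[/eqP-> /eqP->]] //.
  - by have [? ?] := path_adj_mem h; rewrite I1.
  - by have [? ?] := path_adj_mem h; rewrite I2.
  - by rewrite e_sym.
  - by rewrite e_sym.
move: xpq ypq; rewrite !mem_cat => /orP[xp|xq] /orP[yp|yq] exy.
- by rewrite -I1 // exy.
- by have [_ /(_ exy)[[-> ->]|[-> ->]]] := O _ _ xp yq; rewrite !eqxx ?orbT.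
- by rewrite e_sym in exy; have [_ /(_ exy)[[-> ->]|[-> ->]]] := O _ _ yp xq;
    rewrite !eqxx ?orbT.
- by rewrite -I2 // exy ?orbT.
Qed.

End InducedPaths.

(** * Paths leaving the apex *)

Section Arms.
Variables (T : finType) (e : rel T).
Hypotheses (e_sym : symmetric e) (e_irr : irreflexive e).
Hypothesis ehf : even_hole_free e.
Implicit Types (a u v w x y z f g : T) (p q r s F : seq T).
Notation ipath := (ipath e).
Notation only_edge := (only_edge e).
Notation anti := (anti e).

(** The apex is left out of [p], so [size p] is the number of edges on the path from [a] to [u]. *)
Definition arm a x p u := [/\ ipath x p u, only_edge [:: a] p a x & e a x].

(** Weaker than [only_edge]: all edges from [F] to [p] start at [f], which may have several
    neighbours on [p]. *)
Definition only_end F p f := {in F & p, forall z w, z != w /\ (e z w -> z = f)}.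

Lemma only_end_focus F p p' f u : only_end F p f -> {subset p' <= p} ->
  only_edge [:: f] p' f u -> only_edge F p' f u.
Proof.
move=> H sp O z w zF wp; have [n h] := H _ _ zF (sp _ wp); split=> // ezw.
have zf := h ezw; move: ezw; rewrite zf; exact: (O _ _ (mem_head _ _) wp).2.
Qed.

Lemma anti_arm a x p u p' : arm a x p u -> {subset p' <= p} -> x \notin p' ->
  anti [:: a] p'.
Proof.
case=> _ O _ sp xp'; apply: (anti_sym e_sym).
apply: anti_only_edge xp'; apply: (only_edge_sym e_sym).
exact: only_edge_sub O.
Qed.

(** The hole consists of [a], then [p], then [q] backwards; the size bound makes its length at least
    four. *)
Lemma arms_meet a x p b y q c : arm a x p b -> arm a y q c -> e b c ->
  only_edge p q b c -> 3 <= size p + size q -> odd (1 + size p + size q).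
Proof.
move=> [Pp Op ax] [Pq Oq ay] bc O sz.
have : hole e ((a :: p) ++ rev q); last first.
  by move/ehf; rewrite size_cat size_rev.
apply: (ipath_hole e_sym (ipath_cons e_sym e_irr Pp ax Op) (ipath_rev Pq) bc).
- by rewrite e_sym.
- move=> z w; rewrite in_cons mem_rev => /orP[/eqP->|zp] wq.
    by have [? h] := Oq _ _ (mem_head _ _) wq; split=> // /h[_ ->]; right.
  by have [? h] := O _ _ zp wq; split=> // /h[-> ->]; left.
- by rewrite size_rev.
Qed.

(** The hole consists of [a], [p], [F], and [q] backwards. Each of the three lists is nonempty, so
    its length is at least four. *)
Lemma arms_link a x p u y q v f F g :
  arm a x p u -> arm a y q v -> ipath f F g -> anti [:: a] F ->
  e u f -> only_edge p F u f -> e g v -> only_edge F q g v -> anti p q ->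
  odd (1 + size p + size F + size q).
Proof.
move=> [Pp Op ax] [Pq Oq ay] PF AF uf OpF gv OFq Apq.
have PFq := ipath_cat e_sym PF (ipath_rev Pq) gv (only_edge_revr OFq).
have sp := ipath_size Pp; have sF := ipath_size PF; have sq := ipath_size Pq.
have : hole e ((a :: p) ++ (F ++ rev q)); last first.
  by move/ehf; rewrite !size_cat size_rev addnA.
apply: (ipath_hole e_sym (ipath_cons e_sym e_irr Pp ax Op) PFq uf).
- by rewrite e_sym.
- move=> z w; rewrite in_cons mem_cat mem_rev => /orP[/eqP->|zp] /orP[wF|wq].
  + by have [? /negP] := AF _ _ (mem_head _ _) wF.
  + by have [? h] := Oq _ _ (mem_head _ _) wq; split=> // /h[_ ->]; right.
  + by have [? h] := OpF _ _ zp wF; split=> // /h[-> ->]; left.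
  + by have [? /negP] := Apq _ _ zp wq.
- by rewrite size_cat size_rev /=; lia.
Qed.

Lemma has_first (N : pred T) p : has N p -> exists p1 u p2,
  [/\ p = rcons p1 u ++ p2, N u & ~~ has N p1].
Proof. by case/split_find => u p1 p2 Nu h1; exists p1, u, p2. Qed.

Lemma arm_first a x p b f : arm a x p b -> f \notin p -> has (e f) p ->
  exists u pu pr, [/\ p = pu ++ pr, arm a x pu u, e f u,
    only_edge [:: f] pu f u & (forall w, w \in pu -> w != u -> ~~ e f w)].
Proof.
move=> [P O ax] fp h.
have [p1 [u [p2 [pE fu h1]]]] := has_first h.
exists u, (rcons p1 u), p2; split=> //.
- split=> //; last by apply: only_edge_sub O => // z; rewrite pE mem_cat => ->.
  by apply: (@ipath_prefix _ _ _ _ _ p2 b); rewrite -pE.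
- move=> z w; rewrite inE => /eqP-> wp; split.
    by apply: contraNneq fp => ->; rewrite pE mem_cat wp.
  move: wp; rewrite mem_rcons inE => /orP[/eqP->|wp] // efw.
  by case/hasP: h1; exists w.
- move=> w; rewrite mem_rcons inE => /orP[/eqP->|wp]; first by rewrite eqxx.
  by move=> _; apply: contra h1 => fw; apply/hasP; exists w.
Qed.

Lemma ipath_only_end u p v p1 p2 : ipath u p v -> p = p1 ++ p2 -> p2 != [::] ->
  [/\ v \in p2, v \notin p1 & (p1 != [::] -> u \notin p2)].
Proof.
move=> [[U _] [_ h l]] pE n2.
have v2 : v \in p2.
  rewrite -l pE last_cat; case: (p2) n2 => // z s _; by rewrite /= mem_last.
move: U; rewrite pE cat_uniq => /and3P[_ /hasPn D _].
split=> //; first exact: (D _ v2).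
move=> n1; apply/negP=> /D; rewrite pE in h; case: (p1) n1 h => // z s _ [->].
by rewrite mem_head.
Qed.

(** Here [u] and [u'] are the first and last neighbours of [f] on [p]. The four cases are: only [x];
    a single neighbour other than [x], counted in both pieces, whence the change of parity; two
    consecutive vertices; two vertices with a gap between them. A neighbour other than [b]
    guarantees that [u] comes before [b]. *)
Lemma arm_attach a x p b f : arm a x p b -> x != b -> f \notin p ->
    (exists2 w, w \in p & (w != b) && e f w) ->
  exists u pu u' pd,
  [/\ [/\ arm a x pu u, only_edge [:: f] pu f u, e f u, {subset pu <= p} & b \notin pu],
      [/\ ipath u' pd b, only_edge [:: f] pd f u', e f u' & {subset pd <= p}]
    & [\/ [/\ pu = [:: x], pd = p, u = x & u' = x],
          x \notin pd /\ odd (size pu + size pd) = ~~ odd (size p),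
          [/\ x \notin pd, p = pu ++ pd, only_edge pu pd u u' & e u u']
        | x \notin pd /\ anti pu pd]].
Proof.
move=> A xb fp [w0 w0p /andP[w0b fw0]].
have hp : has (e f) p by apply/hasP; exists w0.
have [u [pu [pr [pE Au fu Ou fst]]]] := arm_first A fp hp.
have [P O ax] := A; have [Pu _ _] := Au.
have [xpu upu] := ipath_mem Pu.
have [pu' puE] : exists pu', pu = rcons pu' u by case: Pu => _ /path_ends_rcons.
(* Otherwise [u] is [b], and [w0] would be an earlier neighbour of [f]. *)
have npr : pr != [::].
  apply/eqP=> prE; rewrite prE cats0 in pE.
  have ub : u = b by have [_ [_ _ l]] := P; rewrite -l pE puE last_rcons.
  by move: (fst w0); rewrite -pE w0p ub w0b fw0 => /(_ isT isT).
have [bpr bpu xpr] := ipath_only_end P pE npr.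
have xpr' : x \notin pr by apply: xpr; rewrite puE; case: (pu').
have subu : {subset pu <= p} by move=> z; rewrite pE mem_cat => ->.
have subr : {subset pr <= p} by move=> z; rewrite pE mem_cat orbC => ->.
(* The remainder is searched backwards, so that a first hit there is the last neighbour on [p];
   without a hit, [u] is the only neighbour. *)
have [hr|nhr] := boolP (has (e f) (rev pr)); last first.
  have pE2 : p = pu' ++ u :: pr by rewrite pE puE cat_rcons.
  have Pd : ipath u (u :: pr) b by apply: (@ipath_suffix _ _ x pu'); rewrite -pE2.
  have subd : {subset u :: pr <= p} by move=> z; rewrite pE2 mem_cat orbC => ->.
  exists u, pu, u, (u :: pr); split=> //.
    split=> // z w; rewrite inE => /eqP-> wp; split.
      by apply: contraNneq fp => ->; apply: subd.
    move: wp; rewrite inE => /orP[/eqP->|wp] // fw.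
    by case/hasP: nhr; exists w; rewrite // mem_rev.
  have [xu|xu] := eqVneq x u.
    have pu'E : pu' = [::].
      case: (pu') puE Pu => // z s -> [[U _] [_ /= [zx] _]].
      by move: U; rewrite /= zx xu mem_rcons mem_head.
    by apply: Or41; rewrite pE puE pu'E xu.
  apply: Or42; split; first by rewrite inE negb_or xu.
  by rewrite pE size_cat /= addnS.
have [q1 [u' [q2 [rE fu' h1]]]] := has_first hr.
have prE : pr = rev q2 ++ u' :: rev q1.
  by rewrite -[pr]revK rE rev_cat rev_rcons.
set pd := u' :: rev q1.
have pE2 : p = (pu ++ rev q2) ++ pd by rewrite pE prE catA.
have Pd : ipath u' pd b by apply: (@ipath_suffix _ _ x (pu ++ rev q2)); rewrite -pE2.
have subd' : {subset pd <= pr} by move=> z; rewrite prE mem_cat orbC => ->.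
have subd : {subset pd <= p} by move=> z /subd'/subr.
have xpd : x \notin pd by apply: contra xpr' => /subd'.
exists u, pu, u', pd; split=> //.
  split=> // z w; rewrite inE => /eqP-> wp; split.
    by apply: contraNneq fp => ->; apply: subd.
  move: wp; rewrite inE => /orP[/eqP->|wp] // fw.
  by case/hasP: h1; exists w; rewrite // -mem_rev.
(* [rev q2] is the stretch of [p] strictly between [u] and [u']. *)
have [q2E|nq2] := eqVneq (rev q2) [::].
  rewrite q2E cats0 in pE2; apply: Or43.
  move: (P); rewrite {1}pE2 puE /pd => /ipath_split[].
  by rewrite -puE.
apply: Or44; split=> // z w zp wp.
(* The only edge leaving [pu] along [p] ends at [h0], which lies in the gap and hence not in
   [pd]. *)
have [h0 [q3 q2E]] : exists h0 q3, rev q2 = h0 :: q3.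
  by case: (rev q2) nq2 => // h0 q3; exists h0, q3.
move: (P); rewrite {1}pE prE q2E puE /= => /ipath_split[_ Os].
have [||n h] := Os z w; rewrite -?puE //.
  by rewrite inE mem_cat wp !orbT.
split=> //; apply/negP=> /h[_ wE].
move: wp; rewrite wE; case: (P) => -[U _] _.
move: U; rewrite pE2 cat_uniq q2E => /and3P[_ /hasPn D _] /D.
by rewrite /= mem_cat mem_head orbT.
Qed.

End Arms.

(** * Extended near-prisms *)

Lemma ord3_ind (P : 'I_3 -> Prop) :
  P ord0 -> P ord1_3 -> P ord_max -> forall i, P i.
Proof.
move=> P0 P1 P2 [[|[|[|//]]] h].
- by rewrite (_ : Ordinal h = ord0) //; apply: val_inj.
- by rewrite (_ : Ordinal h = ord1_3) //; apply: val_inj.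
- by rewrite (_ : Ordinal h = ord_max) //; apply: val_inj.
Qed.

(** The third entry is the default value of [nth], returned at index 2. *)
Definition triple (A : Type) (x0 x1 x2 : A) (i : 'I_3) : A :=
  nth x2 [:: x0; x1] i.

Section ExtendedNearPrism.
Variables (T : finType) (e : rel T).
Hypotheses (e_sym : symmetric e) (e_irr : irreflexive e).
Implicit Types (a u v w x y z f g : T) (p q r s F : seq T).
Notation ipath := (ipath e).
Notation only_edge := (only_edge e).
Notation anti := (anti e).
Notation only_end := (only_end e).
Notation arm := (arm e).

Lemma triple_inj x0 x1 x2 : e x0 x1 -> e x0 x2 -> e x1 x2 ->
  injective (triple x0 x1 x2).
Proof.
move=> e01 e02 e12.
have ne u v : e u v -> u != v by move=> h; apply: contraTneq h => ->; rewrite e_irr.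
have [n01 n02 n12] := And3 (ne _ _ e01) (ne _ _ e02) (ne _ _ e12).
have [n10 n20 n21] : [/\ x1 != x0, x2 != x0 & x2 != x1] by split; rewrite eq_sym.
by elim/ord3_ind; elim/ord3_ind; rewrite /triple //= => /eqP h; exfalso;
  move: h; apply/negP.
Qed.

Lemma triple_edge x0 x1 x2 u v : e x0 x1 -> e x0 x2 -> e x1 x2 ->
  triangle_adj (triple x0 x1 x2) u v -> e u v.
Proof.
move=> e01 e02 e12 /and3P[uv /codomP[i uE] /codomP[j vE]]; move: uv.
rewrite {}uE {}vE; elim/ord3_ind: i; elim/ord3_ind: j; rewrite /triple /= ?eqxx //.
all: by rewrite e_sym.
Qed.

Lemma triple_adj x0 x1 x2 i j : e x0 x1 -> e x0 x2 -> e x1 x2 -> i != j ->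
  triangle_adj (triple x0 x1 x2) (triple x0 x1 x2 i) (triple x0 x1 x2 j).
Proof.
move=> e01 e02 e12 ij; apply/and3P; split; try exact: codom_f.
by rewrite (inj_eq (triple_inj e01 e02 e12)).
Qed.

(** The triangles are [f u u'] and [c d b]. The third path may be a single vertex, in which case
    [u' = b] is the common vertex of the triangles. *)
Lemma extended_near_prism a y f b c d (R0 R1 R2 : seq T) u u' :
    ipath f R0 c -> ipath u R1 d -> ipath u' R2 b ->
    e f u -> e f u' -> e u u' -> e c d -> e c b -> e d b ->
    y \in interior R0 -> a \in interior R1 -> e y a ->
    {in R0 & R1, forall z w, z != w /\
      (e z w -> [\/ z = f /\ w = u, z = c /\ w = d | z = y /\ w = a])} ->
    {in R0 & R2, forall z w, z != w /\
      (e z w -> z = f /\ w = u' \/ z = c /\ w = b)} ->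
    {in R1 & R2, forall z w, z != w /\
      (e z w -> z = u /\ w = u' \/ z = d /\ w = b)} ->
    f != c -> u != d ->
  induced_extended_near_prism e (triple f u u') (triple c d b)
    (triple R0 R1 R2) y a.
Proof.
move=> P0 P1 P2 fu fu' uu' cd cb db yi ai eya O01 O02 O12 fc ud.
have [m0 l0] := ipath_mem P0; have [m1 l1] := ipath_mem P1; have [m2 l2] := ipath_mem P2.
set cc := triple f u u'; set dd := triple c d b; set R := triple R0 R1 R2.
have PR i : ipath (cc i) (R i) (dd i) by elim/ord3_ind: i.
have injc : injective cc by apply: triple_inj.
have injd : injective dd by apply: triple_inj.
(* The required adjacency. Once it is known to be symmetric, three of the six ordered pairs of
   distinct paths suffice. *)
pose K := [rel z w | [|| near_prism_adj cc dd R z w,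
  (z == y) && (w == a) | (z == a) && (w == y)]].
have Ksym z w : K z w -> K w z.
  rewrite /K /near_prism_adj /triangle_adj /paths_adj /=.
  case/or3P=> [/or3P[/and3P[h1 h2 h3]|/and3P[h1 h2 h3]|/existsP[i h]]|/andP[h1 h2]|/andP[h1 h2]].
  - by rewrite eq_sym h1 h2 h3.
  - by rewrite (eq_sym w z) h1 h2 h3 !orbT.
  - by apply/orP; left; apply/or3P; apply: Or33; apply/existsP; exists i; rewrite path_adj_sym.
  - by rewrite h1 h2 !orbT.
  - by rewrite h1 h2 !orbT.
have Kc i j : i != j -> K (cc i) (cc j).
  by move=> ij; rewrite /K /near_prism_adj /= [triangle_adj cc _ _]triple_adj.
have Kd i j : i != j -> K (dd i) (dd j).
  by move=> ij; rewrite /K /near_prism_adj /= [triangle_adj dd _ _]triple_adj // orbT.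
have Kya : K y a by rewrite /K /= !eqxx !orbT.
have Kfu : K f u by apply: (Kc ord0 ord1_3).
have Kfu' : K f u' by apply: (Kc ord0 ord_max).
have Kuu' : K u u' by apply: (Kc ord1_3 ord_max).
have Kcd : K c d by apply: (Kd ord0 ord1_3).
have Kcb : K c b by apply: (Kd ord0 ord_max).
have Kdb : K d b by apply: (Kd ord1_3 ord_max).
have H01 : {in R0 & R1, forall z w, z != w /\ (e z w -> K z w)}.
  move=> z w zR wR; have [? h] := O01 _ _ zR wR; split=> //.
  by case/h => -[-> ->].
have H02 : {in R0 & R2, forall z w, z != w /\ (e z w -> K z w)}.
  move=> z w zR wR; have [? h] := O02 _ _ zR wR; split=> //.
  by case/h => -[-> ->].
have H12 : {in R1 & R2, forall z w, z != w /\ (e z w -> K z w)}.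
  move=> z w zR wR; have [? h] := O12 _ _ zR wR; split=> //.
  by case/h => -[-> ->].
have flip p q : {in p & q, forall z w, z != w /\ (e z w -> K z w)} ->
    {in q & p, forall z w, z != w /\ (e z w -> K z w)}.
  move=> H z w zq wp; have [n h] := H _ _ wp zq; rewrite eq_sym e_sym.
  by split=> // /h/Ksym.
have H i j : i != j -> {in R i & R j, forall z w, z != w /\ (e z w -> K z w)}.
  by elim/ord3_ind: i; elim/ord3_ind: j => //= _; rewrite /R /triple //=; apply: flip.
split.
- split=> //.
  (* Ends of different paths differ because the paths are disjoint; for a common index, [fc] and
     [ud] leave only the third. *)
  + move=> i j cd_ij; have [ij|ij] := eqVneq i j; last first.
      have ci : cc i \in R i by have [] := ipath_mem (PR i).
      have dj : dd j \in R j by have [] := ipath_mem (PR j).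
      by have [/eqP] := H _ _ ij _ _ ci dj.
    move: cd_ij; rewrite -ij; elim/ord3_ind: (i); rewrite /cc /dd /triple //=.
      by move=> E; rewrite E eqxx in fc.
    by move=> E; rewrite E eqxx in ud.
  + by move=> i; case: (PR i).
  + move=> i j ij z zi; apply/negP=> zj.
    by have [/eqP] := H _ _ ij _ _ zi zj.
- by [].
- by [].
- move=> z w; rewrite !inE => /existsP[i zi] /existsP[j wj].
  change (e z w = K z w); apply/idP/idP.
    have [ij|ij] := eqVneq i j; last by case: (H _ _ ij _ _ zi wj).
    move: zi wj; rewrite ij => zj wj; case: (PR j) => -[U I] _; rewrite I // => h.
    rewrite /K /near_prism_adj /=; apply/orP; left; apply/or3P; apply: Or33.
    by apply/existsP; exists j.
  rewrite /K /near_prism_adj /=.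
  case/or3P=> [/or3P[||/existsP[l h]]|/andP[/eqP-> /eqP->]|/andP[/eqP-> /eqP->]] //.
  + exact: triple_edge.
  + exact: triple_edge.
  + have [zl wl] := path_adj_mem h; by case: (PR l) => -[U I] _; rewrite I.
  + by rewrite e_sym.
Qed.

End ExtendedNearPrism.

(** * Two legs joined by an induced path *)

Section Attachments.
Variables (T : finType) (e : rel T).
Hypotheses (e_sym : symmetric e) (e_irr : irreflexive e).
Hypothesis ehf : even_hole_free e.
Implicit Types (a b c d u v w x y z f g : T) (p q r s F : seq T).
Notation ipath := (ipath e).
Notation only_edge := (only_edge e).
Notation anti := (anti e).
Notation only_end := (only_end e).
Notation arm := (arm e).

(** Abstracts a rung: [x] and [b] lie in the disjoint sets [A_i] and [B_i], so a leg has at least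
    two vertices. *)
Definition leg a x p b := arm a x p b /\ x != b.
Definition legs p b q c := e b c /\ only_edge p q b c.

(* [pu] leads from the apex to the first neighbour [u] of [f] on the leg [p], and
   [pd] from the last neighbour [u'] of [f] to [b]; possibly [u = u']. *)
Definition attached a x p b f u pu u' pd :=
  [/\ arm a x pu u, only_edge [:: f] pu f u, e f u, {subset pu <= p} & b \notin pu] /\
  [/\ ipath u' pd b, only_edge [:: f] pd f u', e f u' & {subset pd <= p}].

Lemma legs_sym p b q c : legs p b q c -> legs q c p b.
Proof. by case=> bc O; split; [rewrite e_sym | apply: only_edge_sym]. Qed.

Lemma leg_size a x p b : leg a x p b -> 2 <= size p.
Proof.
case=> -[[_ [_ h l]] _ _]; case: p h l => [|x0 [|x1 p]] //= [->] ->.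
by rewrite eqxx.
Qed.

(** Two legs and the apex form a hole of length [1 + size p + size q], which is odd. *)
Lemma legs_parity a x p b y q c : leg a x p b -> leg a y q c -> legs p b q c ->
  odd (size p) = odd (size q).
Proof.
move=> Lp Lq [bc O]; have sp := leg_size Lp; have sq := leg_size Lq.
have := arms_meet e_sym e_irr ehf Lp.1 Lq.1 bc O; lia.
Qed.

Lemma only_end_rev F p f : only_end F p f -> only_end (rev F) p f.
Proof. by move=> H z w; rewrite mem_rev; apply: H. Qed.

Lemma anti_revl p q : anti p q -> anti (rev p) q.
Proof. by move=> H z w; rewrite mem_rev; apply: H. Qed.

Section Link.
Variables (a x : T) (p : seq T) (b y : T) (q : seq T) (c z : T) (r : seq T) (d : T).
Variables (F : seq T) (f g : T).
Hypotheses (Lp : leg a x p b) (Lq : leg a y q c) (Lr : leg a z r d).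
Hypotheses (Opq : legs p b q c) (Opr : legs p b r d) (Oqr : legs q c r d).
Hypotheses (PF : ipath f F g) (AF : anti [:: a] F) (Fr : anti F r).
Hypotheses (Fp : only_end F p f) (Fq : only_end F q g).

(** The hole runs through the apex, [pu], [F] and [qu]. *)
Lemma attached_top u pu u' pd v qu v' qd :
  attached a x p b f u pu u' pd -> attached a y q c g v qu v' qd ->
  odd (1 + size pu + size F + size qu).
Proof.
move=> [[Au Ou fu spu bpu] _] [[Av Ov gv squ cqu] _].
apply: (arms_link e_sym e_irr ehf Au Av PF AF) => //.
- by rewrite e_sym.
- by apply: only_edge_sym => //; exact: (only_end_focus Fp spu Ou).
- by exact: (only_end_focus Fq squ Ov).
- by exact: (anti_only_edge (only_edge_sub spu squ Opq.2) bpu).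
Qed.

(** The cycle avoids the apex: it runs through [F], [qd], the edge from [c] to [b], and [pd]. *)
Lemma attached_bottom u pu u' pd v qu v' qd :
  attached a x p b f u pu u' pd -> attached a y q c g v qu v' qd ->
  odd (size F + size qd + size pd).
Proof.
move=> [_ [Pd Od fu spd]] [_ [Qd Ov gv sqd]].
have sF := ipath_size PF; have sp := ipath_size Pd; have sq := ipath_size Qd.
(* All three lists are nonempty, so a shorter cycle is a triangle, whose length is odd anyway. *)
have [sz|sz] := leqP 4 (size F + size qd + size pd); last by lia.
have OF := only_end_focus Fq sqd Ov.
have PFd := ipath_cat e_sym PF Qd gv OF.
have [bc O] := Opq; rewrite e_sym in bc.
have : hole e ((F ++ qd) ++ rev pd); last first.
  by move/ehf; rewrite !size_cat size_rev.
apply: (ipath_hole e_sym PFd (ipath_rev Pd) bc).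
- by rewrite e_sym.
- move=> s t; rewrite mem_cat mem_rev => /orP[sin|sin] tin.
    have [n h] := only_end_focus Fp spd Od sin tin; split=> // /h; by right.
  by have [n h] := only_edge_sym e_sym O (sqd _ sin) (spd _ tin); split=> // /h; left.
- by rewrite size_cat size_rev.
Qed.

(** The hole runs from the apex along [qu], [F] backwards, [pd], the edge from [b] to [d], and back
    along [r]. As [x] is not in [pd], the apex has no neighbour there. *)
Lemma attached_third u pu u' pd v qu v' qd :
  attached a x p b f u pu u' pd -> attached a y q c g v qu v' qd -> x \notin pd ->
  odd (1 + size qu + size F + size pd + size r).
Proof.
move=> [_ [Pd Od fu spd]] [[Av Ov gv squ cqu] _] xpd.
have PFd : ipath g (rev F ++ pd) b.
  apply: ipath_cat (ipath_rev PF) Pd fu _ => //.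
  by apply: only_end_focus (only_end_rev Fp) spd Od.
have := @arms_link _ _ e_sym e_irr ehf _ _ _ _ _ _ _ _ _ _ Av Lr.1 PFd.
rewrite size_cat size_rev addnA; apply.
- apply: anti_catr; first exact: anti_revr.
  exact: (anti_arm e_sym Lp.1).
- by rewrite e_sym.
- apply: only_edge_catr; apply: only_edge_sym => //.
    by apply: only_end_focus (only_end_rev Fq) squ Ov.
  apply: only_edge_anti; apply: anti_sym => //.
  apply: anti_only_edge cqu; apply: only_edge_sym => //.
  by apply: only_edge_sub Opq.2.
- exact: Opr.1.
- apply: only_edge_catl; first by apply: only_edge_anti; apply: anti_revl.
  by apply: only_edge_sub Opr.2.
- by apply: anti_only_edge cqu; apply: only_edge_sub Oqr.2.
Qed.

(** The hole runs through the apex, [pu], the vertex [f], [pd] and [r]; the apex and [f] together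
    contribute two, which drops out of the parity. *)
Lemma attached_loop u pu u' pd :
  attached a x p b f u pu u' pd -> x \notin pd -> anti pu pd ->
  odd (size pu + size pd + size r).
Proof.
move=> [[Au Ou fu spu bpu] [Pd Od fu' spd]] xpd Apd.
have PFd : ipath f (f :: pd) b := ipath_cons e_sym e_irr Pd fu' Od.
have := @arms_link _ _ e_sym e_irr ehf _ _ _ _ _ _ _ _ _ _ Au Lr.1 PFd.
have -> : odd (1 + size pu + size (f :: pd) + size r) = odd (size pu + size pd + size r).
  by rewrite -[size (f :: pd)]/((size pd).+1); clear; lia.
have fF : {subset [:: f] <= F}.
  by move=> s; rewrite inE => /eqP->; have [] := ipath_mem PF.
rewrite -[f :: pd]/([:: f] ++ pd); apply.
- apply: anti_catr; first by apply: anti_sub AF.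
  exact: (anti_arm e_sym Lp.1).
- by rewrite e_sym.
- apply: only_edge_catr; first by apply: only_edge_sym.
  exact: only_edge_anti.
- exact: Opr.1.
- apply: only_edge_catl; first by apply: only_edge_anti; apply: anti_sub Fr.
  by apply: only_edge_sub Opr.2.
- by apply: anti_only_edge bpu; apply: only_edge_sub Opr.2.
Qed.

(** The leg [p] is attached at two adjacent vertices and [q] only at [y]. The three paths lead from
    the triangle [f u u'] to the triangle [c d b]; the second passes through the apex, and the edge
    from [y] to [a] crosses to the first. *)
Lemma attached_near_prism u pu u' pd :
  attached a x p b f u pu u' pd -> x \notin pd ->
  only_edge pu pd u u' -> e u u' -> attached a y q c g y [:: y] y q ->
  induced_extended_near_prism e (triple f u u') (triple c d b)
    (triple (F ++ q) (rev pu ++ a :: r) pd) y a.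
Proof.
move=> [[Au Ou fu spu bpu] [Pd Od fu' spd]] xpd Oud uu' [_ [Pq Oq gy _]].
have [[_ _ ay] yc] := Lq; have [[Pr Or az] zd] := Lr; have [[_ _ ax] _] := Lp.
have OFq : only_edge F q g y by exact: (only_end_focus Fq (fun t h => h) Oq).
have [Pu Oau _] := Au.
have OFu : only_edge F pu f u by exact: (only_end_focus Fp spu Ou).
have OFd : only_edge F pd f u' by exact: (only_end_focus Fp spd Od).
have P0 : ipath f (F ++ q) c by apply: ipath_cat PF Pq gy OFq.
have Pa : ipath a (a :: r) d := ipath_cons e_sym e_irr Pr az Or.
have P1 : ipath u (rev pu ++ a :: r) d.
  apply: ipath_cat (ipath_rev Pu) Pa _ _ => //; first by rewrite e_sym.
  rewrite -[a :: r]/([:: a] ++ r); apply: only_edge_catr.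
    apply: only_edge_sym => //; exact: only_edge_revr.
  apply: only_edge_anti; apply: anti_revl.
  by apply: anti_only_edge bpu; apply: only_edge_sub Opr.2.
have Aad : anti [:: a] pd by apply: (anti_arm e_sym Lp.1).
(* As [y != c], the vertex [y] lies strictly inside [F ++ q]. *)
have [qu qE] : exists qu, q = y :: rcons qu c.
  have [q1 q1E] := path_ends_cons Pq.2; have [q2 q2E] := path_ends_rcons Pq.2.
  case: q2 q2E => [|y' q2] q2E; first by move: q1E yc; rewrite q2E => -[->]; rewrite eqxx.
  by exists q2; move: q1E; rewrite q2E => -[-> _].
have [F' FE] := path_ends_cons PF.2.
have [pu' puE] := path_ends_rcons Pu.2.
have [r' rE] := path_ends_rcons Pr.2.
have cnF : c \notin F.
  apply/negP=> cF; have cq := (ipath_mem Pq).2.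
  by have [/eqP] := OFq _ _ cF cq.
have [fF gF] := ipath_mem PF.
apply: extended_near_prism P0 P1 Pd fu fu' uu' _ _ _ _ _ _ _ _ _ _ _ => //.
- exact: Oqr.1.
- by rewrite e_sym; exact: Opq.1.
- by rewrite e_sym; exact: Opr.1.
- have -> : interior (F ++ q) = F' ++ y :: qu.
    rewrite /interior FE qE /= -rcons_cons -rcons_cat /=.
    by case: (F') => [|? ?] /=; rewrite ?belast_rcons.
  by rewrite mem_cat mem_head orbT.
- have -> : interior (rev pu ++ a :: r) = rev pu' ++ a :: r'.
    rewrite /interior puE rev_rcons rE /= -rcons_cons -rcons_cat /=.
    by case: (rev pu') => [|? ?] /=; rewrite ?belast_rcons.
  by rewrite mem_cat mem_head orbT.
- by rewrite e_sym.
- move=> s t; rewrite !mem_cat mem_rev inE => /orP[sF|sq] /or3P[tp|/eqP->|tr].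
  + by have [? h] := OFu _ _ sF tp; split=> // /h; apply: Or31.
  + by have [] := AF (mem_head _ _) sF; rewrite eq_sym e_sym => ? /negP.
  + by have [? /negP] := Fr sF tr.
  + have [? /negP] := anti_only_edge (only_edge_sub spu (fun t h => h) Opq.2) bpu tp sq.
    by rewrite eq_sym e_sym.
  + have [[_ O _] _] := Lq; have [? h] := O _ _ (mem_head _ _) sq.
    by rewrite eq_sym e_sym; split=> // /h[_ ->]; apply: Or33.
  + by have [? h] := Oqr.2 _ _ sq tr; split=> // /h; apply: Or32.
- move=> s t; rewrite mem_cat => /orP[sF|sq] td.
  + by have [? h] := OFd _ _ sF td; split=> // /h; left.
  + have [? h] := only_edge_sym e_sym Opq.2 sq (spd _ td); by split=> // /h; right.
- move=> s t; rewrite mem_cat mem_rev inE => /or3P[sp|/eqP->|sr] td.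
  + by have [? h] := Oud _ _ sp td; split=> // /h; left.
  + by have [? /negP] := Aad _ _ (mem_head _ _) td.
  + have [? h] := only_edge_sym e_sym Opr.2 sr (spd _ td); by split=> // /h; right.
- by apply: contraNneq cnF => <-.
- apply/eqP=> ud; have dr := (ipath_mem Pr).2; have upu := (ipath_mem Pu).2.
  by have [/eqP] := Opr.2 _ _ (spu _ upu) dr.
Qed.

End Link.
End Attachments.

(** * Parity contradictions for linked legs *)

Section LinkedLegs.
Variables (T : finType) (e : rel T).
Hypotheses (e_sym : symmetric e) (e_irr : irreflexive e).
Hypothesis ehf : even_hole_free e.
Implicit Types (a b c d u v w x y z f g : T) (p q r s F : seq T).
Notation ipath := (ipath e).
Notation only_edge := (only_edge e).
Notation anti := (anti e).
Notation only_end := (only_end e).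
Notation arm := (arm e).
Notation leg := (leg e).
Notation legs := (legs e).
Notation attached := (attached e).

Lemma only_end_notin F p f g : only_end F p f -> g \in F -> g \notin p.
Proof. by move=> H gF; apply/negP=> gp; have [/eqP] := H _ _ gF gp. Qed.

(* On an attached leg: [x] is the only neighbour of [f], or [f] has exactly two
   neighbours and they are adjacent. *)
Definition tight x p u pu u' pd :=
  [/\ pu = [:: x], pd = p, u = x & u' = x] \/
  [/\ x \notin pd, p = pu ++ pd, only_edge pu pd u u' & e u u'].

(** Adding [attached_top] and [attached_third] shows that [size pu + size pd] has the parity of
    [size r], hence of [size p]. This excludes the case of a single neighbour other than [x];
    [attached_loop] excludes the case of a gap. *)
Lemma attached_tight a x p b y q c z r d F f g v qu v' qd :
  leg a x p b -> leg a y q c -> leg a z r d ->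
  legs p b q c -> legs p b r d -> legs q c r d ->
  ipath f F g -> anti [:: a] F -> anti F r -> only_end F p f -> only_end F q g ->
  attached a y q c g v qu v' qd ->
  (exists2 w, w \in p & (w != b) && e f w) ->
  exists u pu u' pd, attached a x p b f u pu u' pd /\ tight x p u pu u' pd.
Proof.
move=> Lp Lq Lr Opq Opr Oqr PF AF Fr Fp Fq Aq hp.
have fp := only_end_notin Fp (ipath_mem PF).1.
have [u [pu [u' [pd [A1 A2 cases]]]]] := arm_attach Lp.1 Lp.2 fp hp.
have Ap : attached a x p b f u pu u' pd by split.
exists u, pu, u', pd; split=> //.
have top := attached_top e_sym e_irr ehf Opq PF AF Fp Fq Ap Aq.
have third := attached_third e_sym e_irr ehf Lp Lr Opq Opr Oqr PF AF Fr Fp Fq Ap Aq.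
have par := legs_parity e_sym e_irr ehf Lp Lr Opr.
case: cases => [|[xpd]|| [xpd Apd]]; [by left | | by right |].
  by move: (third xpd); lia.
have := attached_loop e_sym e_irr ehf Lp Lr Opr PF AF Fr Ap xpd Apd.
by move: (third xpd); lia.
Qed.

(** If both legs are attached only at their first vertices, the top hole makes [size F] even and the
    bottom cycle makes it odd. If both are attached at two adjacent vertices, the two lengths sum to
    an odd number modulo [2 * size F]. The mixed cases give the forbidden near-prism. *)
Lemma linked_legs_absurd a x p b y q c z r d F f g :
  (forall (c d : 'I_3 -> T) (R : 'I_3 -> seq T) (x y : T),
     induced_extended_near_prism e c d R x y -> ~ (a = x \/ a = y)) ->
  leg a x p b -> leg a y q c -> leg a z r d ->
  legs p b q c -> legs p b r d -> legs q c r d ->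
  ipath f F g -> anti [:: a] F -> anti F r -> only_end F p f -> only_end F q g ->
  (exists2 w, w \in p & (w != b) && e f w) ->
  (exists2 w, w \in q & (w != c) && e g w) -> False.
Proof.
move=> enp Lp Lq Lr Opq Opr Oqr PF AF Fr Fp Fq hp hq.
have Oqp := legs_sym e_sym Opq.
have PF' := ipath_rev PF; have AF' := anti_revr AF; have Fr' := anti_revl Fr.
have Fp' := only_end_rev Fp; have Fq' := only_end_rev Fq.
have gq := only_end_notin Fq (ipath_mem PF).2.
(* An arbitrary attachment on [q] is enough to make [p] tight; the result then makes [q] tight, with
   [F] reversed. *)
have [v0 [qu0 [v'0 [qd0 [B1 B2 _]]]]] := arm_attach Lq.1 Lq.2 gq hq.
have [u [pu [u' [pd [Ap tp]]]]] := attached_tight Lp Lq Lr Opq Opr Oqr PF AF Fr Fp Fq (conj B1 B2) hp.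
have [v [qu [v' [qd [Aq tq]]]]] := attached_tight Lq Lp Lr Oqp Oqr Opr PF' AF' Fr' Fq' Fp' Ap hq.
have top := attached_top e_sym e_irr ehf Opq PF AF Fp Fq Ap Aq.
have bot := attached_bottom e_sym ehf Opq PF Fp Fq Ap Aq.
have par := legs_parity e_sym e_irr ehf Lp Lq Opq.
case: tp => [[puE pdE uE u'E]|[xpd pE Oud uu']];
case: tq => [[quE qdE vE v'E]|[yqd qE Ovd vv']].
- by move: top bot; rewrite puE quE pdE qdE /=; lia.
- rewrite puE pdE uE u'E in Ap.
  have := attached_near_prism e_sym e_irr Lq Lp Lr Oqp Oqr Opr PF' AF' Fr' Fq' Fp' Aq yqd Ovd vv' Ap.
  by move/enp; apply; right.
- rewrite quE qdE vE v'E in Aq.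
  have := attached_near_prism e_sym e_irr Lp Lq Lr Opq Opr Oqr PF AF Fr Fp Fq Ap xpd Oud uu' Aq.
  by move/enp; apply; right.
- move: top bot par; rewrite pE qE !size_cat; lia.
Qed.

(** The hole closes through the single vertex [f] and has length [size p + size q + 2]. *)
Lemma arms_through_vertex a x p u y q v f : arm a x p u -> arm a y q v ->
  f != a -> ~~ e a f -> only_edge [:: f] p f u -> e f u -> only_edge [:: f] q f v -> e f v ->
  anti p q -> odd (size p + size q).
Proof.
move=> Ap Aq fa af Op fu Oq fv Apq.
have := arms_link e_sym e_irr ehf Ap Aq (ipath1 e_irr f) _ _ _ fv Oq Apq.
rewrite /= => H; have : odd (1 + size p + 1 + size q); last by lia.
apply: H; [|by rewrite e_sym|exact: only_edge_sym].
by move=> s t; rewrite !inE => /eqP-> /eqP->; rewrite eq_sym.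
Qed.

(** The three arms from the apex to first neighbours of [f] would have pairwise different
    parities. *)
Lemma attached_three_legs_absurd a x p b y q c z r d f :
  leg a x p b -> leg a y q c -> leg a z r d ->
  legs p b q c -> legs p b r d -> legs q c r d ->
  f != a -> ~~ e a f -> f \notin p -> f \notin q -> f \notin r ->
  (exists2 w, w \in p & (w != b) && e f w) ->
  (exists2 w, w \in q & (w != c) && e f w) ->
  has (e f) r -> False.
Proof.
move=> Lp Lq Lr Opq Opr Oqr fa af fp fq fr hp hq hr.
have [u [pu [_ [_ [[Au Ou fu spu bpu] _ _]]]]] := arm_attach Lp.1 Lp.2 fp hp.
have [v [qu [_ [_ [[Av Ov fv squ cqu] _ _]]]]] := arm_attach Lq.1 Lq.2 fq hq.
(* [ru] may reach [d]; it is still anticomplete to [pu] and [qu], since these avoid [b] and [c]. *)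
have [w [ru [rr [rE Aw fw Ow _]]]] := arm_first Lr.1 fr hr.
have sru : {subset ru <= r} by move=> t; rewrite rE mem_cat => ->.
have puqu := anti_only_edge (only_edge_sub spu squ Opq.2) bpu.
have puru := anti_only_edge (only_edge_sub spu sru Opr.2) bpu.
have quru := anti_only_edge (only_edge_sub squ sru Oqr.2) cqu.
have := arms_through_vertex Au Av fa af Ou fu Ov fv puqu.
have := arms_through_vertex Au Aw fa af Ou fu Ow fw puru.
have := arms_through_vertex Av Aw fa af Ov fv Ow fw quru.
lia.
Qed.

(* Otherwise [F] closes two holes of different parities, through [q] and through [r]. *)
Lemma linked_arm_complete a x p u y q c z r d F f g :
  arm a x p u -> leg a y q c -> leg a z r d -> legs q c r d ->
  anti p q -> anti p r ->
  ipath f F g -> anti [:: a] F -> e u f -> only_edge p F u f ->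
  only_edge F q g c -> only_edge F r g d -> e g c -> e g d.
Proof.
move=> Ap Lq Lr Oqr Apq Apr PF AF uf Fu Fq Fr gc; apply/negPn/negP=> gd.
have viaq := arms_link e_sym e_irr ehf Ap Lq.1 PF AF uf Fu gc Fq Apq.
have AFr : anti F r.
  move=> s t sF tr; have [n h] := Fr _ _ sF tr; split=> //.
  by apply/negP=> est; have [sg td] := h est; rewrite sg td (negbTE gd) in est.
have [[Pq Oaq _] yc] := Lq; have cq := (ipath_mem Pq).2.
have c1 : {subset [:: c] <= q} by move=> s; rewrite inE => /eqP->.
(* As [g] misses [d], the second hole passes from [g] through [c] to [d]. Since [q] and [r] have the
   same parity, the extra vertex [c] makes the two lengths differ in parity. *)
have PFc : ipath f (F ++ [:: c]) c.
  apply: (ipath_cat e_sym PF (ipath1 e_irr c) gc); exact: only_edge_sub Fq.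
have := arms_link e_sym e_irr ehf Ap Lr.1 PFc _ uf _ Oqr.1 _ Apr.
have par := legs_parity e_sym e_irr ehf Lq Lr Oqr.
rewrite size_cat /= => H; have : odd (1 + size p + (size F + 1) + size r); last by lia.
apply: H.
- apply: anti_catr => //; apply: (anti_arm e_sym Lq.1) => //.
  by rewrite inE.
- apply: only_edge_catr => //; apply: only_edge_anti; exact: anti_sub Apq.
- apply: only_edge_catl; first exact: only_edge_anti.
  exact: only_edge_sub Oqr.2.
Qed.

(** By induction the walk after [f] contains an induced path; [f] is then joined to its last
    neighbour there, or the path is cut at [f] if it already contains it. *)
Lemma ipath_exists f p g : path e f p -> last f p = g ->
  exists2 t, ipath f t g & {subset t <= f :: p}.
Proof.
elim: p f => [|h p IH] f /= => [_ <-|/andP[fh hp] lg].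
  by exists [:: f]; first exact: ipath1.
have [t Pt st] := IH h hp lg.
have st' : {subset t <= [:: f, h & p]} by move=> s /st sp; rewrite inE sp orbT.
have [ft|ft] := boolP (f \in t).
  case/splitPr: ft Pt st' => t1 t2 Pt st'; exists (f :: t2); first exact: ipath_suffix Pt.
  by move=> s s2; apply: st'; rewrite mem_cat s2 orbT.
have hr : has (e f) (rev t) by apply/hasP; exists h; rewrite // mem_rev (ipath_mem Pt).1.
have [t1 [w [t2 [tE fw h1]]]] := has_first hr.
have tE2 : t = rev t2 ++ w :: rev t1 by rewrite -[t]revK tE rev_cat rev_rcons.
exists (f :: w :: rev t1); last first.
  move=> s; rewrite inE => /orP[/eqP->|s1]; first exact: mem_head.
  by apply: st'; rewrite tE2 mem_cat s1 orbT.
have Pw : ipath w (w :: rev t1) g by apply: (@ipath_suffix _ _ h (rev t2)); rewrite -tE2.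
apply: (ipath_cons e_sym e_irr Pw fw) => s k; rewrite inE => /eqP-> kin; split.
  by apply: contraNneq ft => ->; rewrite tE2 mem_cat kin orbT.
move: kin; rewrite inE mem_rev => /orP[/eqP-> //|k1] fk.
by case/hasP: h1; exists k.
Qed.

End LinkedLegs.

(** * Connectivity *)

Section Connectivity.
Variables (T : finType) (e : rel T).
Hypothesis e_sym : symmetric e.
Implicit Types (X Y : {set T}).

Definition within X : rel T := [rel u v | [&& u \in X, v \in X & e u v]].

Lemma within_sub X Y : X \subset Y ->
  subrel (connect (within X)) (connect (within Y)).
Proof.
move=> sXY; apply: connect_sub => u v /and3P[uX vX uv]; apply: connect1.
by rewrite /within /= (subsetP sXY _ uX) (subsetP sXY _ vX).
Qed.

Lemma within_connect_sym X : connect_sym (within X).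
Proof. by apply: sym_connect_sym => u v; rewrite /within /= e_sym andbCA. Qed.

Lemma connected_setP X x y : connected_set e X -> x \in X -> y \in X ->
  connect (within X) x y.
Proof. by move=> /forall_inP h xX yX; exact: (forall_inP (h x xX)). Qed.

Lemma connected_hub X u : {in X, forall x, connect (within X) u x} ->
  connected_set e X.
Proof.
move=> h; apply/forall_inP=> x xX; apply/forall_inP=> y yX.
by apply: connect_trans (h y yX); rewrite within_connect_sym; apply: h.
Qed.

Lemma ipath_connect f p g X : ipath e f p g -> {subset p <= X} ->
  connect (within X) f g.
Proof.
elim: p f => [|f0 p IH] f; first by case=> _ [].
move=> P; have [_ [_ [E] l]] := P; rewrite E in P l * => {f0 E} sX.
case: p IH P l sX => [|h p] IH P l sX; first by rewrite -l.
have [fh _] := ipath_split (P : ipath e f (rcons [::] f ++ h :: p) g).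
apply: connect_trans (IH h _ _); last first.
- by move=> s sin; apply: sX; rewrite inE sin orbT.
- exact: (ipath_suffix (P : ipath e f ([:: f] ++ h :: p) g)).
- by apply: connect1; rewrite /within /= !sX ?inE ?eqxx ?orbT.
Qed.

Lemma connect_leave (r : rel T) X x y : connect r x y -> x \in X -> y \notin X ->
  exists s t, [/\ s \in X, t \notin X & r s t].
Proof.
case/connectP=> p + ->; elim: p x => [|z p IH] x /=; first by move=> _ ->.
case/andP=> xz zp xX; have [zX|zX] := boolP (z \in X); first exact: IH.
by exists x, z.
Qed.

(** An edge leaving [F] inside [Y] must also leave [X]: otherwise its far end could be added to [F],
    against maximality of the component. *)
Lemma component_leave X Y F : component e X F -> connected_set e Y -> F \subset Y ->
  ~~ (Y \subset F) -> exists s t, [/\ s \in F, t \in Y, t \notin X & e s t].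
Proof.
case/andP=> /set0Pn[x xF] /maxsetP[/andP[sFX cF] mx] cY sFY /subsetPn[y yY yF].
have [s [t [sF tF /and3P[sY tY st]]]] :=
  connect_leave (connected_setP cY (subsetP sFY _ xF) yY) xF yF.
exists s, t; split=> //; apply/negP=> tX.
have /mx : (t |: F \subset X) && connected_set e (t |: F).
  rewrite subUset sub1set tX sFX; apply: (@connected_hub _ s) => z.
  rewrite !inE => /orP[/eqP->|zF].
    by apply: connect1; rewrite /within /= !inE sF st eqxx orbT.
  exact: (within_sub (subsetUr _ _)) (connected_setP cF sF zF).
by move/(_ (subsetUr _ _))/setP/(_ t); rewrite !inE eqxx (negbTE tF).
Qed.

End Connectivity.

Lemma interiorE (T : finType) (u v w : T) p : path_ends u v p ->
  (w \in interior p) = [&& w \in p, w != u & w != v].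
Proof.
case=> U h l; case: p h U l => [|u0 p] //= [->].
case/lastP: p => [|p v0]; first by rewrite inE; case: eqP.
rewrite last_rcons belast_rcons mem_rcons inE rcons_uniq /=.
move=> /and3P[/norP[uv up] vp _] <-; rewrite inE mem_rcons inE.
case: (eqVneq w u) => [->|_] /=; first by rewrite (negbTE up).
case: (eqVneq w v0) => [->|_] /=; first by rewrite (negbTE vp).
by rewrite andbT.
Qed.

Lemma third_index k (i j : 'I_k) : 3 <= k -> exists l, l != i /\ l != j.
Proof.
move=> k3; have /subsetPn[l _] : ~~ ([set: 'I_k] \subset [set i; j]).
  apply/negP=> /subset_leq_card; rewrite cardsT card_ord cards2; lia.
by rewrite !inE => /norP[li lj]; exists l.
Qed.

(** * Strip systems *)

Section Strips.
Variables (T : finType) (e : rel T).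
Hypotheses (e_sym : symmetric e) (e_irr : irreflexive e).
Hypothesis ehf : even_hole_free e.
Variables (a : T) (k : nat) (S : 'I_k -> strip T).
Hypothesis sysS : pyramid_strip_system e a S.

Notation V i := (strip_vertices (S i)).
Notation AC i := (sA (S i) :|: sC (S i)).
Notation B i := (sB (S i)).
Notation ipath := (ipath e).
Notation only_edge := (only_edge e).
Notation anti := (anti e).
Notation only_end := (only_end e).
Notation arm := (arm e).
Notation leg := (leg e).
Notation legs := (legs e).

Let k3 : 3 <= k. Proof. by case: sysS. Qed.

Lemma strip_AC i : {subset AC i <= V i}.
Proof. by move=> w; rewrite !inE => /orP[->|->]; rewrite ?orbT. Qed.

Lemma strip_B i : {subset B i <= V i}.
Proof. by move=> w; rewrite !inE => ->; rewrite orbT. Qed.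

Lemma strip_cases i w : w \in V i -> (w \in AC i) || (w \in B i).
Proof. by rewrite !inE orbAC. Qed.

Lemma strip_AC_B i w : w \in AC i -> w \notin B i.
Proof.
case: sysS => _ /(_ i)[[dAB _ dBC] _ _ _] _ _ _.
rewrite inE => /orP[wA|wC]; first by rewrite (disjointFr dAB wA).
by rewrite (disjointFl dBC wC).
Qed.

Lemma strip_inj i j w : w \in V i -> w \in V j -> i = j.
Proof.
move=> wi wj; apply/eqP/negPn/negP=> ij.
by case: sysS => _ _ /(_ i j ij) /disjointFr/(_ wi); rewrite wj.
Qed.

Lemma strip_edge i j : i != j -> {in V i & V j, forall x y,
  e x y = (x \in B i) && (y \in B j)}.
Proof.
case: sysS => _ _ _ h _ ij x y xi yj; case: (ltngtP i j) => [lt|lt|/val_inj E].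
- exact: h.
- by rewrite e_sym (h j i) // andbC.
- by rewrite E eqxx in ij.
Qed.

Lemma apex_notin i : a \notin V i.
Proof. by case: sysS => _ _ _ _ /(_ i)[]. Qed.

Lemma apex_edge i w : w \in V i -> e a w = (w \in sA (S i)).
Proof. by case: sysS => _ _ _ _ /(_ i)[_]; apply. Qed.

(** The last clause says that [b] is the only vertex of the rung in [B_i]. *)
Definition rung_leg i x p b :=
  [/\ leg a x p b, x \in sA (S i), b \in B i, {subset p <= V i}
    & forall w, w \in p -> (w \in AC i) = (w != b)].

Lemma rung_leg_exists i v : v \in V i -> exists p x b, rung_leg i x p b /\ v \in p.
Proof.
move=> vV; case: sysS => _ /(_ i)[[dAB dAC dBC] _ _ /(_ v vV)[p [Ip [x [b [E xA bB sIC]]]] vp]] _ _ _.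
have pV w : w \in p -> [\/ w = x, w = b | w \in sC (S i)].
  move=> wp; have [->|wx] := eqVneq w x; first by apply: Or31.
  have [->|wb] := eqVneq w b; first by apply: Or32.
  by apply/Or33/sIC; rewrite (interiorE _ E) wp wx.
have sp : {subset p <= V i}.
  by move=> w /pV[->|->|wC]; rewrite !inE ?xA ?bB ?wC ?orbT.
exists p, x, b; split=> //; split=> //; last first.
  move=> w wp; have [->|wb] := eqVneq w b.
    by apply/negbTE; apply: contraL bB; apply: strip_AC_B.
  by case: (pV w wp) wb => [->|->|wC]; rewrite ?eqxx // inE ?xA ?wC ?orbT.
have xp := (path_ends_mem E).1.
split; last by apply: contraTneq bB => <-; rewrite (disjointFr dAB xA).
split=> //; last by rewrite (apex_edge (sp _ xp)).
move=> z w; rewrite inE => /eqP-> wp; split.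
  by apply: contraNneq (apex_notin i) => ->; apply: sp.
rewrite (apex_edge (sp _ wp)) => wA; split=> //; case: (pV w wp) => // [wb|wC].
  by rewrite wb (disjointFl dAB bB) in wA.
by rewrite (disjointFl dAC wC) in wA.
Qed.

Lemma rungs_legs i j p b q c : i != j ->
  b \in B i -> {subset p <= V i} -> (forall w, w \in p -> (w \in AC i) = (w != b)) ->
  c \in B j -> {subset q <= V j} -> (forall w, w \in q -> (w \in AC j) = (w != c)) ->
  legs p b q c.
Proof.
move=> ij bB sp hp cB sq hq; split.
  by rewrite (strip_edge ij) ?strip_B // bB.
move=> z w zp wq; split.
  by apply: contraNneq ij => zw; apply/eqP/(@strip_inj _ _ z); [exact: sp | rewrite zw; exact: sq].
rewrite (strip_edge ij) ?sp ?sq // => /andP[zB wB]; split; apply/eqP/negPn.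
  by rewrite -(hp _ zp); apply: contraL zB; apply: strip_AC_B.
by rewrite -(hq _ wq); apply: contraL wB; apply: strip_AC_B.
Qed.

Definition touches f (X : {set T}) := [exists x in X, e f x].

(** Pointwise form of lying outside both the strip system and the closed neighbourhood of the
    apex. *)
Definition outside s := [&& s != a, ~~ e a s & [forall i, s \notin V i]].

Lemma outside_notin s i : outside s -> s \notin V i.
Proof. by case/and3P=> _ _ /forallP. Qed.

Lemma outside_anti F : {in F, forall s, outside s} -> anti [:: a] F.
Proof.
move=> out z w; rewrite inE => /eqP-> /out/and3P[wa aw _].
by rewrite eq_sym.
Qed.

Lemma untouched_anti (F r : seq T) i : {in F, forall s, outside s} -> {subset r <= V i} ->
  {in F, forall s, ~~ touches s (V i)} -> anti F r.
Proof.
move=> out sr h s w sF wr; split.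
  by apply: contraTneq (sr _ wr) => <-; apply: outside_notin; apply: out.
by apply: contra (h s sF) => sw; apply/existsP; exists w; rewrite sr.
Qed.

Lemma touches_only_end (F p : seq T) f i : {in F, forall s, outside s} -> {subset p <= V i} ->
  {in F, forall s, touches s (V i) -> s = f} -> only_end F p f.
Proof.
move=> out sr h s w sF wr; split.
  by apply: contraTneq (sr _ wr) => <-; apply: outside_notin; apply: out.
by move=> sw; apply: h => //; apply/existsP; exists w; rewrite sr.
Qed.

Lemma touches_AC f i : touches f (AC i) -> touches f (V i).
Proof. by case/existsP=> x /andP[xA fx]; apply/existsP; exists x; rewrite strip_AC. Qed.

Lemma touches_leg f i : touches f (AC i) -> exists p x b,
  rung_leg i x p b /\ exists2 w, w \in p & (w != b) && e f w.
Proof.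
case/existsP=> w /andP[wAC fw]; have [p [x [b [R wp]]]] := rung_leg_exists (strip_AC wAC).
exists p, x, b; split=> //; exists w; rewrite // fw andbT.
by case: R => _ _ _ _ <-.
Qed.

Section Crossing.
Variables (F : seq T) (f g : T).
Hypotheses (PF : ipath f F g) (outF : {in F, forall s, outside s}).
Hypothesis enp : forall (c d : 'I_3 -> T) (R : 'I_3 -> seq T) (x y : T),
  induced_extended_near_prism e c d R x y -> ~ (a = x \/ a = y).

(** Rungs through neighbours of [f] and [g], with any rung of a third strip, serve as the three
    legs. Other strips are assumed untouched only when [f != g], since a single vertex may touch
    several strips. *)
Lemma crossing_AC_absurd i j : i != j -> touches f (AC i) -> touches g (AC j) ->
  {in F, forall s, touches s (V i) -> s = f} ->
  {in F, forall s, touches s (V j) -> s = g} ->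
  (f != g -> forall l, l != i -> l != j -> {in F, forall s, ~~ touches s (V l)}) ->
  False.
Proof.
move=> ij fi gj onlyi onlyj none.
have [p [x [b [[Lp xA bB sp hp] np]]]] := touches_leg fi.
have [q [y [c [[Lq yA cB sq hq] nq]]]] := touches_leg gj.
have [l [li lj]] := third_index i j k3.
have [d0 d0B] : exists d, d \in B l by case: sysS => _ /(_ l)[_ _ /set0Pn].
have [r [z [d [[Lr zA dB sr hr] _]]]] := rung_leg_exists (strip_B d0B).
have Opq := rungs_legs ij bB sp hp cB sq hq.
have Opr : legs p b r d by apply: (@rungs_legs i l); rewrite // eq_sym.
have Oqr : legs q c r d by apply: (@rungs_legs j l); rewrite // eq_sym.
have [fF gF] := ipath_mem PF.
suff Fr : anti F r.
  apply: (linked_legs_absurd e_sym e_irr ehf enp Lp Lq Lr Opq Opr Oqr PF) => //.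
  - exact: outside_anti.
  - exact: touches_only_end onlyi.
  - exact: touches_only_end onlyj.
(* When [F] is a single vertex, a neighbour on the third rung is excluded by the three-parity
   argument. *)
have [fg|fg] := eqVneq f g; last by apply: (untouched_anti outF sr); apply: none.
have F1 s : s \in F -> s = f.
  case: (PF) => -[U _] [_ h lst]; case: (F) h lst U => // s0 F0 [->].
  case/lastP: F0 => [|F0 s1]; first by rewrite inE => _ _ /eqP.
  by rewrite /= last_rcons fg => ->; rewrite /= mem_rcons mem_head.
have outf := outF fF; case/and3P: (outf) => fa af _.
move=> s w sF wr; split.
  by apply: contraTneq (sr _ wr) => <-; apply: outside_notin; apply: outF.
rewrite (F1 s sF); apply/negP=> fw.
have notin (X : seq T) m : {subset X <= V m} -> f \notin X.
  by move=> sX; apply/negP=> /sX; apply/negP; apply: outside_notin.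
apply: (attached_three_legs_absurd e_sym e_irr ehf Lp Lq Lr Opq Opr Oqr fa af) => //.
- exact: (notin p i).
- exact: (notin q j).
- exact: (notin r l).
- by rewrite fg.
- by apply/hasP; exists w.
Qed.

(** The arm leads through the strip [S_i] to the first neighbour of [f]; comparing holes through two
    further strips spreads the adjacency of [g] over all the other sets [B_l]. *)
Lemma crossing_B i j : i != j -> touches f (AC i) -> touches g (B j) ->
  (forall s l, s \in F -> touches s (AC l) -> l = i /\ s = f) ->
  (forall s l, s \in F -> l != i -> touches s (V l) -> s = g) ->
  (forall l, l != i -> {in B l, forall c, e g c}) /\
  exists x p u, [/\ arm a x p u, x \in sA (S i), {subset p <= AC i}, e u f &
     only_edge p F u f].
Proof.
move=> ij fi gj onlyi onlyj.
have [p [x [b [[Lp xA bB sp hp] np]]]] := touches_leg fi.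
have [fF gF] := ipath_mem PF.
have fp : f \notin p.
  by apply/negP=> /sp; apply/negP; apply: outside_notin; apply: outF.
have [u [pu [_ [_ [[Au Ou fu spu bpu] _ _]]]]] := arm_attach Lp.1 Lp.2 fp np.
(* [pu] avoids [b], the only vertex of the rung in [B_i]. *)
have puAC : {subset pu <= AC i}.
  by move=> w wp; rewrite hp ?spu //; apply: contraNneq bpu => <-.
have Fpu : only_edge pu F u f.
  apply: only_edge_sym => //; apply: (@only_end_focus _ _ F pu pu f u _ _ Ou) => // s w sF wp; split.
    by apply: contraTneq (strip_AC (puAC _ wp)) => <-; apply: outside_notin; apply: outF.
  by move=> sw; case: (onlyi s i sF) => //; apply/existsP; exists w; rewrite puAC.
have uf : e u f by rewrite e_sym.
have spread l m : l != i -> m != i -> l != m -> {in B l & B m, forall c d, e g c -> e g d}.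
  move=> li mi lm c0 d0 cB0 dB0.
  have [q [y [c [[Lq yA cB sq hq] cq]]]] := rung_leg_exists (strip_B cB0).
  have [r [z [d [[Lr zA dB sr hr] dr]]]] := rung_leg_exists (strip_B dB0).
  have cE : c0 = c.
    by apply/eqP/negPn; rewrite -hq //; apply: contraL cB0; apply: strip_AC_B.
  have dE : d0 = d.
    by apply/eqP/negPn; rewrite -hr //; apply: contraL dB0; apply: strip_AC_B.
  rewrite cE dE.
  have oe t n h : n != i -> {subset t <= V n} -> (forall w, w \in t -> (w \in AC n) = (w != h)) ->
      only_edge F t g h.
    move=> ni st ht s w sF wt; split.
      by apply: contraTneq (st _ wt) => <-; apply: outside_notin; apply: outF.
    move=> sw; have -> : s = g by apply: (onlyj s n) => //; apply/existsP; exists w; rewrite st.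
    split=> //; apply/eqP/negPn; rewrite -ht //; apply/negP=> wAC.
    have [|ni' _] := onlyi s n sF; first by apply/existsP; exists w; rewrite wAC.
    by rewrite ni' eqxx in ni.
  have Apu n t : n != i -> {subset t <= V n} -> anti pu t.
    move=> ni st s w sp' wt; have sAC := puAC _ sp'; split.
      apply: contraNneq ni => sw; apply/eqP/(@strip_inj _ _ w); first exact: st.
      by rewrite -sw strip_AC.
    rewrite e_sym (strip_edge ni) ?st ?strip_AC //.
    by rewrite (negbTE (strip_AC_B sAC)) andbF.
  apply: (linked_arm_complete e_sym e_irr ehf Au Lq Lr _ _ _ PF _ uf Fpu) => //.
  - exact: (rungs_legs lm).
  - exact: (Apu l).
  - exact: (Apu m).
  - exact: outside_anti.
  - exact: (oe q l).
  - exact: (oe r m).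
split; last by exists x, pu, u.
have [c0 /andP[c0B gc0]] := existsP gj.
have ji : j != i by rewrite eq_sym.
(* Adjacency spreads only between different strips, so other vertices of [B_j] are reached by a
   detour through a third strip. *)
move=> l li d dB; have [lj|lj] := eqVneq j l; last exact: (spread j l) gc0.
have [m [mi mj]] := third_index i j k3.
have [t tB] : exists t, t \in B m by case: sysS => _ /(_ m)[_ _ /set0Pn].
apply: (spread m l _ _ _ t d) => //; first by rewrite -lj.
by apply: (spread j m _ _ _ c0 t) => //; rewrite eq_sym.
Qed.

End Crossing.
End Strips.

(** * Enlarging a strip *)

Section Enlarge.
Variables (T : finType) (e : rel T).
Hypotheses (e_sym : symmetric e) (e_irr : irreflexive e).
Variables (a : T) (k : nat) (S : 'I_k -> strip T).
Hypothesis indS : indecomposable_system e a S.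
Let sysS : pyramid_strip_system e a S := indS.1.

Notation V i := (strip_vertices (S i)).
Notation AC i := (sA (S i) :|: sC (S i)).
Notation B i := (sB (S i)).
Notation ipath := (ipath e).
Notation only_edge := (only_edge e).
Notation arm := (arm e).
Notation touches := (touches e).

Variables (F : seq T) (f g : T) (i : 'I_k).
Hypotheses (PF : ipath f F g) (outF : {in F, forall s, outside e a S s}).
Hypothesis onlyB : forall s l, s \in F -> l != i -> touches s (V l) -> s = g.
Hypothesis g_AC : forall l, l != i -> ~~ touches g (AC l).
Hypothesis g_B : forall l, l != i -> {in B l, forall c, e g c}.
Variables (x u : T) (p : seq T).
Hypotheses (Ap : arm a x p u) (xA : x \in sA (S i)) (pAC : {subset p <= AC i}).
Hypotheses (uf : e u f) (OpF : only_edge p F u f).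

(** The vertex [g] behaves towards the other strips like a vertex of [B_i]; the rest of [F] has no
    neighbours there and goes into [C_i]. *)
Definition enlarged j :=
  if j == i then Strip (sA (S i)) (g |: sB (S i)) (sC (S i) :|: [set s in F] :\ g)
  else S j.

Let gF : g \in F. Proof. exact: (ipath_mem PF).2. Qed.

Let outV s j : s \in F -> s \notin V j.
Proof. by move=> sF; apply: outside_notin; apply: outF. Qed.

Let outX s : s \in F -> [/\ s \notin sA (S i), s \notin sB (S i) & s \notin sC (S i)].
Proof. by move=> sF; have := outV i sF; rewrite !inE => /norP[/norP[]]. Qed.

Lemma enlarged_vertices :
  strip_vertices (enlarged i) = V i :|: [set s in F].
Proof.
rewrite /enlarged eqxx /strip_vertices /=; apply/setP=> s; rewrite !inE.
have [->|] := eqVneq s g; first by rewrite gF !orbT.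
by move=> _ /=; rewrite !orbA.
Qed.

Lemma enlarged_other j : j != i -> enlarged j = S j.
Proof. by rewrite /enlarged => /negbTE->. Qed.

Lemma enlarged_subset j : V j \subset strip_vertices (enlarged j).
Proof.
have [->|ji] := eqVneq j i; last by rewrite enlarged_other.
by rewrite enlarged_vertices subsetUl.
Qed.

Lemma enlarged_rung q : rung e (S i) q -> rung e (enlarged i) q.
Proof.
case=> Iq [s [t [E sA tB sub]]]; split=> //; exists s, t; rewrite /enlarged eqxx.
by split=> //= [|w /sub wC]; rewrite !inE ?tB ?wC ?orbT.
Qed.

(** This one rung covers all of [F]. The only neighbour of the apex on [p] is [x], so the other
    vertices of [p] lie in [C_i]. *)
Lemma enlarged_new_rung : rung e (enlarged i) (p ++ F).
Proof.
have [Pp Oap ax] := Ap.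
have [IQ EQ] := ipath_cat e_sym Pp PF uf OpF.
split=> //; exists x, g; rewrite /enlarged eqxx; split=> //=.
  by rewrite !inE eqxx.
move=> w; rewrite (interiorE _ EQ) mem_cat => /and3P[/orP[wp|wF] wx wg]; rewrite !inE.
  have := pAC wp; rewrite inE => /orP[wA|->] //.
  have aw : e a w by rewrite (apex_edge sysS (strip_AC (pAC wp))).
  by have [_ /(_ aw)[_ /eqP]] := Oap _ _ (mem_head _ _) wp; rewrite (negbTE wx).
by rewrite wg wF orbT.
Qed.

Lemma enlarged_proper j : proper_strip e (enlarged j).
Proof.
have [->|ji] := eqVneq j i; last by rewrite enlarged_other //; case: sysS.
have [_ /(_ i)[[dAB dAC dBC] A0 B0 rungs] _ _ _] := sysS.
have [gA gB gC] := outX gF.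
have dis (X Y : {set T}) : {in X, forall s, s \notin Y} -> [disjoint X & Y].
  by move=> h; rewrite disjoint_subset; apply/subsetP=> s /h.
split.
- rewrite /enlarged eqxx /=; split; apply: dis => s.
  + move=> sA; rewrite !inE (disjointFr dAB sA) orbF.
    by apply: contraNneq gA => <-.
  + move=> sA; rewrite !inE (disjointFr dAC sA) /= negb_and.
    by apply/orP; right; apply/negP=> /outX[]; rewrite sA.
  + rewrite !inE => /orP[/eqP->|sB]; first by rewrite (negbTE gC) eqxx.
    rewrite (disjointFr dBC sB) /= negb_and.
    by apply/orP; right; apply/negP=> /outX[]; rewrite sB.
- by rewrite /enlarged eqxx.
- by apply/set0Pn; exists g; rewrite /enlarged eqxx !inE eqxx.
- move=> v; rewrite enlarged_vertices in_setU => /orP[/rungs[q rq vq]|].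
    by exists q; first exact: enlarged_rung.
  rewrite inE => vF; exists (p ++ F); first exact: enlarged_new_rung.
  by rewrite mem_cat vF orbT.
Qed.

Lemma enlarged_edge_new s j t : s \in F -> j != i -> t \in V j ->
  e s t = (s == g) && (t \in B j).
Proof.
move=> sF ji tV; apply/idP/andP=> [st|[/eqP-> tB]]; last exact: (g_B ji).
have sg : s = g by apply: (onlyB sF ji); apply/existsP; exists t; rewrite tV.
split; first exact/eqP.
case/orP: (strip_cases tV) => // tAC; case/negP: (g_AC ji).
by apply/existsP; exists t; rewrite tAC -sg.
Qed.

Lemma enlarged_edge_left j s t : j != i -> s \in strip_vertices (enlarged i) ->
  t \in V j -> e s t = (s \in sB (enlarged i)) && (t \in B j).
Proof.
move=> ji; rewrite enlarged_vertices in_setU /enlarged eqxx /= => /orP[sV|sF] tV.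
  have ij : i != j by rewrite eq_sym.
  rewrite (strip_edge e_sym sysS ij sV tV) !inE.
  by case: (eqVneq s g) => // E; rewrite E (negbTE (outV i gF)) in sV.
rewrite inE in sF; rewrite (enlarged_edge_new sF ji tV) !inE.
by have [_ /negbTE-> _] := outX sF; rewrite orbF.
Qed.

Lemma enlarged_edge j l : j != l ->
  {in strip_vertices (enlarged j) & strip_vertices (enlarged l),
    forall s t, e s t = (s \in sB (enlarged j)) && (t \in sB (enlarged l))}.
Proof.
move=> jl s t; have [ji|ji] := eqVneq j i.
  have li : l != i by rewrite eq_sym -ji.
  by rewrite ji (enlarged_other li); apply: enlarged_edge_left.
have [li|li] := eqVneq l i.
  rewrite li (enlarged_other ji) => sV tV.
  by rewrite e_sym andbC; apply: enlarged_edge_left.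
by rewrite !enlarged_other //; exact: (strip_edge e_sym sysS jl).
Qed.

Lemma enlarged_system : pyramid_strip_system e a enlarged.
Proof.
split.
- by case: sysS.
- exact: enlarged_proper.
- move=> j l jl; rewrite disjoint_subset; apply/subsetP=> s sj; rewrite inE.
  have aux m n : m != n -> s \in strip_vertices (enlarged m) -> s \in V n -> n != i -> False.
    have [->|mi] := eqVneq m i.
      rewrite enlarged_vertices in_setU => ni /orP[sV|].
        by move/(strip_inj sysS sV) => E; rewrite E eqxx in ni.
      by rewrite inE => /(outV n)/negP.
    by rewrite enlarged_other // => mn sm sn _; rewrite (strip_inj sysS sm sn) eqxx in mn.
  apply/negP=> sl; have [li|li] := eqVneq l i; last first.
    by apply: (aux j l) => //; rewrite enlarged_other in sl.
  have ji : j != i by rewrite -li.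
  by apply: (aux l j); rewrite // 1?eq_sym // -(enlarged_other ji).
- by move=> j l jl; apply: enlarged_edge; apply: contraTneq jl => ->; rewrite ltnn.
- move=> j; have [->|ji] := eqVneq j i; last by rewrite enlarged_other //; case: sysS.
  rewrite enlarged_vertices; split.
    rewrite in_setU negb_or (apex_notin sysS) inE.
    by apply/negP=> /outF/and3P[]; rewrite eqxx.
  move=> s; rewrite in_setU /enlarged eqxx /= => /orP[sV|]; first exact: (apex_edge sysS).
  rewrite inE => sF; have [/negbTE-> _ _] := outX sF.
  by have /and3P[_ /negbTE] := outF sF.
Qed.

(** The vertex [u] serves as a hub: the old [A_i :|: C_i] is connected, and the new vertices of
    [C_i] are reached from [u] along [F]. *)
Lemma enlarged_indecomposable : indecomposable_system e a enlarged.
Proof.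
split; first exact: enlarged_system.
move=> j; have [->|ji] := eqVneq j i; last by rewrite enlarged_other //; apply: indS.2.
have upu := (ipath_mem (let: And3 P _ _ := Ap in P)).2.
have uAC := pAC upu.
rewrite /indecomposable_strip /enlarged eqxx /= setUA.
apply: (@connected_hub _ _ e_sym _ u) => s; rewrite in_setU => /orP[sAC|].
  apply: (within_sub (subsetUl _ _)); exact: (connected_setP (indS.2 i) uAC sAC).
rewrite !inE => /andP[sg sF].
(* The part of [F] up to [s] misses its last vertex [g], so it stays inside the new set [C_i]. *)
have [F1 [F2 FE]] : exists F1 F2, F = rcons F1 s ++ F2.
  by case/splitPr: sF => F1 F2; exists F1, F2; rewrite cat_rcons.
have F2n : F2 != [::].
  apply: contraNneq sg => F2E; have [_ [_ _ lst]] := PF.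
  by rewrite -lst FE F2E cats0 last_rcons.
have [_ gF1 _] := ipath_only_end PF FE F2n.
have P1 : ipath f (rcons F1 s) s by apply: (@ipath_prefix _ _ _ _ _ F2 g); rewrite -FE.
have sub : {subset rcons F1 s <= AC i :|: [set s in F] :\ g}.
  move=> t tF; rewrite in_setU in_setD1 inE FE mem_cat tF /=.
  by rewrite (_ : t != g) ?orbT //; apply: contraNneq gF1 => <-.
have fF1 := (ipath_mem P1).1.
apply: connect_trans (ipath_connect P1 sub).
apply: connect1; rewrite /within /= uf (sub _ fF1) in_setU uAC //.
Qed.

End Enlarge.

(** * Minimal crossing paths *)

Section NoCrossingPath.
Variables (T : finType) (e : rel T).
Hypotheses (e_sym : symmetric e) (e_irr : irreflexive e).
Hypothesis ehf : even_hole_free e.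
Variables (a : T) (k : nat) (S : 'I_k -> strip T).
Hypothesis enp : forall (c d : 'I_3 -> T) (R : 'I_3 -> seq T) (x y : T),
  induced_extended_near_prism e c d R x y -> ~ (a = x \/ a = y).
Hypothesis maxS : maximal_indecomposable_system e a S.
Let sysS : pyramid_strip_system e a S := maxS.1.1.

Notation V i := (strip_vertices (S i)).
Notation AC i := (sA (S i) :|: sC (S i)).
Notation B i := (sB (S i)).
Notation touches := (touches e).

(** Induction on a bound for [size F] replaces the choice of a shortest crossing path. *)
Lemma no_crossing_path n (F : seq T) f g i j : size F <= n ->
  ipath e f F g -> {in F, forall s, outside e a S s} ->
  i != j -> touches f (AC i) -> touches g (V j) -> False.
Proof.
elim: n F f g i j => [|n IH] F f g i j szF PF outF ij fi gj.
  by have := ipath_size PF; lia.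
have sub1 s : s \in F -> s != g -> exists2 P, ipath e f P s & size P <= n /\ {subset P <= F}.
  move=> sF sg; case/splitPr: sF szF PF outF => F1 F2 szF PF outF.
  exists (rcons F1 s).
    by apply: (@ipath_prefix _ _ _ _ _ F2 g); rewrite cat_rcons.
  split; last by move=> t; rewrite -cat_rcons mem_cat => ->.
  case: F2 szF PF {outF} => [|t F2]; last by rewrite size_rcons size_cat /=; lia.
  by move=> _ [_ [_ _]]; rewrite last_cat /= => E; rewrite E eqxx in sg.
have sub2 s : s \in F -> s != f -> exists2 P, ipath e s P g & size P <= n /\ {subset P <= F}.
  move=> sF sf; case/splitPr: sF szF PF outF => F1 F2 szF PF outF.
  exists (s :: F2); first exact: ipath_suffix PF.
  split; last by move=> t t2; rewrite mem_cat t2 orbT.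
  case: F1 szF PF {outF} => [|t F1]; last by rewrite size_cat /=; lia.
  by move=> _ [_ [_ [E] _]]; rewrite E eqxx in sf.
(* Proper segments of [F] do not cross, by induction: [pre] treats initial ones, [suf] final ones,
   and [suf'] final ones read backwards from [g]. *)
have pre s l m : s \in F -> s != g -> l != m -> touches f (AC l) -> touches s (V m) -> False.
  move=> sF sg lm fl sm; have [P Pp [szP sP]] := sub1 s sF sg.
  by apply: (IH P f s l m) => // t /sP/outF.
have suf s l m : s \in F -> s != f -> l != m -> touches s (AC l) -> touches g (V m) -> False.
  move=> sF sf lm sl gm; have [P Pp [szP sP]] := sub2 s sF sf.
  by apply: (IH P s g l m) => // t /sP/outF.
have suf' s l m : s \in F -> s != f -> l != m -> touches g (AC l) -> touches s (V m) -> False.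
  move=> sF sf lm gl sm; have [P Pp [szP sP]] := sub2 s sF sf.
  apply: (IH (rev P) g s l m) => //; rewrite ?size_rev //; first exact: ipath_rev.
  by move=> t; rewrite mem_rev => /sP/outF.
have [fF gF] := ipath_mem PF.
have caseI l m : l != m -> touches f (AC l) -> touches g (AC m) -> False.
  move=> lm fl gm; have ml : m != l by rewrite eq_sym.
  apply: (crossing_AC_absurd e_sym e_irr ehf sysS PF outF enp lm fl gm).
  - by move=> s sF sl; apply/eqP/negPn/negP=> sf; apply: (suf' s m l).
  - by move=> s sF sm; apply/eqP/negPn/negP=> sg; apply: (pre s l m).
  - move=> fg h hl hm s sF; apply/negP=> sh; have [sg|sg] := eqVneq s g.
      have sf : s != f by rewrite sg eq_sym.
      by apply: (suf' s m h) => //; rewrite eq_sym.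
    by apply: (pre s l h) => //; rewrite eq_sym.
have fiV := touches_AC fi.
(* A further vertex touching some [A_l :|: C_l] either starts or ends a shorter crossing segment, or
   brings the situation back to [caseI]. *)
have onlyAC s l : s \in F -> touches s (AC l) -> l = i /\ s = f.
  move=> sF sl; have [sf|sf] := eqVneq s f.
    split=> //; apply/eqP/negPn/negP=> li; have il : i != l by rewrite eq_sym.
    have [fg|fg] := eqVneq f g; first by apply: (caseI i l); rewrite // -fg -sf.
    by apply: (pre f i l); rewrite // -sf; apply: touches_AC.
  exfalso; have lj : l = j.
    by apply/eqP/negPn/negP=> lj; apply: (suf s l j).
  have [sg|sg] := eqVneq s g; first by apply: (caseI i l); rewrite ?lj // -sg -lj.
  by apply: (pre s i j) => //; rewrite -lj; apply: touches_AC.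
have onlyB s l : s \in F -> l != i -> touches s (V l) -> s = g.
  by move=> sF li sl; apply/eqP/negPn/negP=> sg; apply: (pre s i l); rewrite // eq_sym.
have gB : touches g (B j).
  case/existsP: gj => w /andP[wV gw]; apply/existsP; exists w; rewrite gw andbT.
  case/orP: (strip_cases wV) => // wAC; exfalso; apply: (caseI i j) => //.
  by apply/existsP; exists w; rewrite wAC.
have [gall [x [p [u [Ap xA pAC uf OpF]]]]] :=
  crossing_B e_sym e_irr ehf sysS PF outF ij fi gB onlyAC onlyB.
have gAC l : l != i -> ~~ touches g (AC l).
  by move=> li; apply/negP=> /(onlyAC g l gF)[E]; rewrite E eqxx in li.
have ind := enlarged_indecomposable e_sym maxS.1 PF outF onlyB gAC gall Ap xA pAC uf OpF.
(* By maximality the enlarged system has the same vertices, but it contains [g], which is outside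
   [S]. *)
have := maxS.2 _ _ ind; rewrite /system_vertices => eqV.
have : g \in a |: \bigcup_j V j.
  rewrite -eqV; last first.
    apply: setUS; apply/bigcupsP=> l _; apply: (bigcup_max l) => //.
    exact: (enlarged_subset S i PF l).
  rewrite in_setU; apply/orP; right; apply/bigcupP; exists i => //.
  by rewrite (enlarged_vertices S i PF) in_setU inE gF orbT.
have gout := outF g gF; case/and3P: (gout) => ga _ _.
rewrite !inE (negbTE ga) => /bigcupP[l _]; apply/negP; exact: outside_notin gout.
Qed.

End NoCrossingPath.

(** * Attachments of a component *)

Theorem mainTheorem4 (T : finType) (e : rel T)
    (e_sym : symmetric e) (e_irr : irreflexive e)
    (ehf : even_hole_free e) (a : T) (a_splendid : splendid e a)
    (no_enp : forall (c d : 'I_3 -> T) (R : 'I_3 -> seq T) (x y : T),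
       induced_extended_near_prism e c d R x y -> ~ (a = x \/ a = y))
    (k : nat) (S : 'I_k -> strip T)
    (S_max : maximal_indecomposable_system e a S)
    (F : {set T})
    (F_comp : component e (~: (system_vertices a S :|: cnbh e a)) F) :
  (attachments e a S F != set0 /\
   attachments e a S F \subset \bigcup_i sB (S i)) \/
  (exists i : 'I_k,
     attachments e a S F \subset strip_vertices (S i) /\
     attachments e a S F :&: (sB (S i) :|: sC (S i)) != set0).
Proof.
have sysS : pyramid_strip_system e a S := S_max.1.1.
have [k3 _ _ _ _] := sysS.
have [cN _ _] := a_splendid.
have /andP[F0 /maxsetp/andP[sF cF]] := F_comp.
have outF s : s \in F -> outside e a S s.
  move/(subsetP sF); rewrite !inE !negb_or => /andP[/andP[sa sV] /andP[_ asN]].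
  rewrite /outside sa asN; apply/forallP=> i; apply: contra sV => sVi.
  by apply/bigcupP; exists i.
have attP v : reflect (exists i, v \in strip_vertices (S i) /\ exists2 s, s \in F & e v s)
    (v \in attachments e a S F).
  rewrite inE; apply: (iffP andP).
    case=> vS /existsP[s /andP[sF' vs]]; move: vS; rewrite !inE => /orP[/eqP va|].
      by have /and3P[_ /negP[]] := outF s sF'; rewrite -va.
    by case/bigcupP=> i _ vi; exists i; split=> //; exists s.
  case=> i [vi [s sF' vs]]; split; last by apply/existsP; exists s; rewrite sF'.
  by rewrite !inE; apply/orP; right; apply/bigcupP; exists i.
have notN i v : v \in strip_vertices (S i) -> v \notin sA (S i) -> v \in ~: cnbh e a.
  move=> vi vA; rewrite !inE negb_or (apex_edge sysS vi) vA andbT.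
  by apply: contraNneq (apex_notin sysS i) => <-.
(* The non-neighbours of the apex form a connected set that contains [F] and some vertex of [B_1],
   so an edge leaves [F] inside this set. It can only end in the strip system, and as its end misses
   the apex, that end is in some [B_i :|: C_i]. This provides nonemptiness in both outcomes. *)
have [t [i0 [tatt ti tBC]]] : exists t i, [/\ t \in attachments e a S F,
    t \in strip_vertices (S i) & t \in sB (S i) :|: sC (S i)].
  pose i1 : 'I_k := Ordinal (ltn_trans (ltn0Sn 1) k3).
  have [_ /(_ i1)[[dAB _ _] _ /set0Pn[b bB] _] _ _ _] := sysS.
  have bV := strip_B bB.
  have bN : b \in ~: cnbh e a by apply: (notN i1); rewrite // (disjointFl dAB bB).
  have sFN : F \subset ~: cnbh e a.
    by apply: subset_trans sF _; rewrite setCS subsetUr.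
  have bF : ~~ (~: cnbh e a \subset F).
    apply/subsetPn; exists b => //; apply/negP=> /outF ob.
    by have := outside_notin i1 ob; rewrite bV.
  have [s [t [sF' tN tX st]]] := component_leave e_sym F_comp cN sFN bF.
  rewrite !inE in tN; move: tX; rewrite !inE negbK (negbTE tN) orbF.
  case/orP=> [ta|]; first by rewrite ta in tN.
  case/bigcupP=> i _ ti; exists t, i; split=> //.
    by apply/attP; exists i; split=> //; exists s; rewrite // e_sym.
  move: tN (ti); rewrite (apex_edge sysS ti) negb_or !inE => /andP[_ /negbTE->].
  by case: (t \in sB _).
have [attB|/subsetPn[v vatt vB]] := boolP (attachments e a S F \subset \bigcup_i sB (S i)).
  by left; split=> //; apply/set0Pn; exists t.
right; have [i [vi [f fF vf]]] := attP v vatt.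
have fi : touches e f (sA (S i) :|: sC (S i)).
  apply/existsP; exists v; rewrite e_sym vf andbT.
  case/orP: (strip_cases vi) => // vBi; case/negP: vB.
  by apply/bigcupP; exists i.
(* An attachment in another strip would give, by connectedness of [F], an induced crossing path
   inside [F]. *)
have sub j w : w \in attachments e a S F -> w \in strip_vertices (S j) -> j = i.
  move=> watt wj; have [_ [_ [g gF wg]]] := attP w watt.
  apply/eqP/negPn/negP=> ji; have ij : i != j by rewrite eq_sym.
  have /connectP[P Pp lP] := connected_setP cF fF gF.
  have sPF : {subset f :: P <= F}.
    move=> s; rewrite inE => /orP[/eqP-> //|].
    elim: P (f) Pp {lP} => // h P IH z /= /andP[/and3P[_ hF _] hP].
    by rewrite inE => /orP[/eqP->|] //; apply: IH hP.
  have Pe : path e f P by apply: sub_path Pp => y z /and3P[].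
  have [Q PQ sQ] := ipath_exists e_sym e_irr Pe (esym lP).
  apply: (no_crossing_path e_sym e_irr ehf no_enp S_max (leqnn (size Q)) PQ _ ij fi).
    by move=> s /sQ/sPF/outF.
  by apply/existsP; exists w; rewrite wj e_sym.
exists i; split; last first.
  by apply/set0Pn; exists t; rewrite in_setI tatt -(sub i0 t tatt ti).
apply/subsetP=> w watt; have [j [wj _]] := attP w watt.
by rewrite -(sub j w watt wj).
Qed.
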